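(* Let $d\ge 1$ be an integer, let $H>0$, and let $X=\{X(t),\ t\ge 0\}$ be a continuous $d$-dimensional fractional Brownian motion, self-similar of index $H$ (in the sense defined in the context), such that the law of $X(1)$ is nondegenerate, that is, the covariance matrix $Q$ of $X(1)$ has rank $d$. For $t\ge 0$ let $V(t)$ be the closed convex hull in $\mathbb{R}^d$ of $\{X(s) : 0\le s\le t\}$. Then, with probability $1$, for all $t>0$ the point $0$ is an interior point of $V(t)$.
   Context: Let $(\Omega,\mathcal{F},\mathbb{P})$ be a probability space. Let $X=\{X(t),\ t\ge 0\}$ be a $d$-dimensional centered Gaussian process defined on $\Omega$ which is self-similar of index $H>0$: for each constant $c>0$ the process $\{X(ct),\ t\ge 0\}$ has the same distribution as $\{c^H X(t),\ t\ge 0\}$. The process $X$ is called a fractional Brownian motion if for each $e\in\mathbb{R}^d$ the scalar process $t\mapsto\langle X(t),e\rangle$ is, up to a constant $c(e)$, a standard one-dimensional fractional Brownian motion, i.e. a centered real Gaussian process with covariance function $\frac12\left(t^{2H}+s^{2H}-|t-s|^{2H}\right)$, $s,t\ge 0$. In this case $c^2(e)=\langle Qe,e\rangle$, where $Q$ is the covariance matrix of $X(1)$, and hence $$\mathbb{E}\,\langle X(t),e\rangle\langle X(s),e\rangle=\langle Qe,e\rangle\,\tfrac12\left(t^{2H}+s^{2H}-|t-s|^{2H}\right),\qquad s,t\ge 0,\ e\in\mathbb{R}^d.$$ ''Continuous'' means that the sample paths $t\mapsto X(t)$ are continuous.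
   Formalization: The case H = 1 is excluded: there X(t) = tX(1) for all t almost surely, V(t) is the segment from 0 to tX(1), and 0 is never an interior point, so the claim fails. *)

(* Defs.v *)
(* MathComp-Analysis, over an abstract realType. *)
From HB Require Import structures.
From mathcomp Require Import all_boot all_order all_algebra.
From mathcomp Require Import all_classical all_reals all_analysis.

Set Implicit Arguments.
Unset Strict Implicit.
Unset Printing Implicit Defensive.

Import Order.TTheory GRing.Theory Num.Theory.
Import numFieldNormedType.Exports.

Local Open Scope classical_set_scope.
Local Open Scope ring_scope.

(* Processes on [0, +oo[ are functions of a time in R; every definition below
   only constrains their values at nonnegative times. *)

Section families.
Context {R : realType} {disp : measure_display} {Omega : measurableType disp}.
Variable P : probability Omega R.

(* normal_prob m 0 is a dummy (uniform on [0, 1]): the degenerate Gaussian law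
   has to be given as a Dirac mass. *)
Definition gaussian_law (m s : R) (A : set R) : \bar R :=
  if s == 0 then \d_m A else normal_prob m s A.

Definition gaussian_rv (Y : Omega -> R) : Prop :=
  measurable_fun setT Y /\
  exists m s : R, forall A : set R, measurable A ->
    P (Y @^-1` A) = gaussian_law m s A.

Context {I : Type}.
Implicit Types (D : set I) (Y Z : I -> Omega -> R).

Definition gaussian_family D Y : Prop :=
  forall (k : nat) (i : 'I_k -> I) (a : 'I_k -> R), (forall j, D (i j)) ->
    gaussian_rv (fun w => \sum_(j < k) a j * Y (i j) w).

Definition centered_family D Y : Prop :=
  forall i, D i -> ('E_P[Y i] = 0)%E.

Definition same_fdd D Y Z : Prop :=
  forall (k : nat) (i : 'I_k -> I), (forall j, D (i j)) ->
    forall B : set (k.-tuple R), measurable B ->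
      P [set w | B [tuple Y (i j) w | j < k]] =
      P [set w | B [tuple Z (i j) w | j < k]].

End families.

Section processes.
Context {R : realType} {disp : measure_display} {Omega : measurableType disp}.
Variable P : probability Omega R.

(* The function is positive semidefinite iff H <= 1. For H = 1 it is t * s, the
   covariance of the degenerate motion t |-> t *: X 1 along a fixed ray. *)
Definition fbm_cov (H t s : R) : R :=
  2^-1 * (t `^ (2 * H) + s `^ (2 * H) - `|t - s| `^ (2 * H)).

Definition standard_fbm (H : R) (B : R -> Omega -> R) : Prop :=
  [/\ gaussian_family P [set t | 0 <= t] B,
      centered_family P [set t | 0 <= t] B &
      forall t s, 0 <= t -> 0 <= s ->
        covariance P (B t) (B s) = (fbm_cov H t s)%:E].

Context {n : nat}.
Implicit Type X : R -> Omega -> 'rV[R]_n.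

(* A vector-valued process is identified with the family of its coordinates,
   indexed by pairs (time, coordinate). *)
Definition coords X (p : R * 'I_n) (w : Omega) : R := X p.1 w 0 p.2.

Definition nonneg_times : set (R * 'I_n) := [set p | 0 <= p.1].

Definition centered_gaussian_process X : Prop :=
  gaussian_family P nonneg_times (coords X) /\
  centered_family P nonneg_times (coords X).

Definition self_similar (H : R) X : Prop :=
  forall c : R, 0 < c ->
    same_fdd P nonneg_times (coords (fun t => X (c * t)))
                            (coords (fun t w => c `^ H *: X t w)).

Definition dotv (u v : 'rV[R]_n) : R := \sum_(i < n) u 0 i * v 0 i.

(* For c = 0 the choice of B is immaterial. B lives on Omega: this loses nothing
   when n > 0 and the covariance matrix of X 1 is nonzero, for then the
   normalised projections of X are themselves standard. *)
Definition fractional_brownian_motion (H : R) X : Prop :=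
  [/\ centered_gaussian_process X,
      self_similar H X &
      forall e : 'rV[R]_n, exists (c : R) (B : R -> Omega -> R),
        standard_fbm H B /\
        forall t w, 0 <= t -> dotv (X t w) e = c * B t w].

Definition continuous_paths X : Prop :=
  forall w, {within [set t : R | 0 <= t], continuous (fun t => X t w)}.

Definition covariance_mx (Y : Omega -> 'rV[R]_n) : 'M[R]_n :=
  \matrix_(i, j) fine (covariance P (fun w => Y w 0 i) (fun w => Y w 0 j)).

End processes.

Definition closed_convex_hull {R : realType} {n : nat} (A : set 'rV[R]_n) :
    set 'rV[R]_n :=
  smallest [set C : set 'rV[R]_n | closed C /\ @convex_set R 'rV[R]_n C] A.

Definition path_hull {R : realType} {Omega : Type} {n : nat}
    (X : R -> Omega -> 'rV[R]_n) (w : Omega) (t : R) : set 'rV[R]_n :=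
  closed_convex_hull [set X s w | s in `[0, t]].

(* Main.v *)
Require Import Defs.
From HB Require Import structures.
From mathcomp Require Import all_boot all_order all_algebra.
From mathcomp Require Import all_classical all_reals all_analysis.
From mathcomp Require Import measurable_realfun ring lra.
Set Implicit Arguments.
Unset Strict Implicit.
Unset Printing Implicit Defensive.
Import Order.TTheory GRing.Theory Num.Theory.
Import numFieldNormedType.Exports.
Local Open Scope classical_set_scope.
Local Open Scope ring_scope.

(** The idea is that the path, observed at a few widely separated small times
    and rescaled by self-similarity, looks like a large sample from the
    nondegenerate centered Gaussian law of X 1, and such a sample cannot stay in
    a half-space.

    Since the variance of B 2 - 2 B 1 is 4 - 4^H for a scalar fractional
    Brownian motion B, the index satisfies H <= 1 ([fbm_hurst_le1]), hence
    H < 1. Then the correlation of B t and B s tends to 0 with s / t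
    ([fbm_cov_small]), so that for given N and T one can choose times
    T >= t_0 > ... > t_(N-1) > 0 for which the vectors z_k = t_k^-H X(t_k) have
    correlations at most 1 / N in every direction ([fbm_sample_times]).

    Along a fixed direction the z_k satisfy a weak law of large numbers for
    their values and for their squares. For the squares this uses the identity
    E U^2 V^2 = E U^2 E V^2 + 2 (E U V)^2 ([gaussian_like_pair]), which follows
    by polarisation from E Y^4 = 3 (E Y^2)^2 applied to combinations of U and
    V. The directions d_i + d_j, where the d_i are the coordinate vectors, are
    enough to control the whole empirical covariance matrix
    ([fbm_sample_estimates]). Only one direction is considered at a time: the
    covariance of different coordinates at different times is not determined by
    the covariances of the scalar projections.

    With probability close to 1, the empirical mean of the z_k is thus small,
    their empirical covariance matrix is close to the covariance matrix Q of
    X 1, which is positive definite, and their fourth moments are bounded. If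
    all the numbers <z_k, e> were nonpositive, the mean of |<z_k, e>| would be
    small, whereas the mean of <z_k, e>^2 is bounded below; this is excluded by
    the bound on the fourth moments ([empirical_direction]). So there is
    kappa > 0 such that every e satisfies <X(t_k), e> >= kappa |e| for some k,
    and a closed convex set with this property contains a ball around 0: the
    nearest-point projection of an outside point would give a direction that
    violates it ([ball_of_directions]).

    Hence for each T the event that 0 is not interior to V(T) is contained in
    events of arbitrarily small probability ([fbm_directions]). As V(t)
    increases with t, it is enough to consider T = 1 / (m + 1). *)

(** * Moments of the normal law *)

Section gauss_moments.
Context {R : realType}.
Local Notation mu := (@lebesgue_measure R).
Implicit Types (x y : R).
Import gauss_integral_proof.
Local Notation G := (@integral0_gauss R).

(** The antiderivatives of [x ^+ 2 * gauss_fun x] and [x ^+ 4 * gauss_fun x]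
    involve the antiderivative [G] of the Gaussian function itself. *)
Lemma is_derive_integral0_gauss x : 0 < x -> is_derive x 1 G (gauss_fun x).
Proof.
move=> x0; have [||||d1 d2] := @continuous_FTC1 R gauss_fun (BLeft 0) x (x + 1).
- by rewrite ltrDl.
- by apply: integrableS (@integrableT_gauss R).
- by rewrite /= lte_fin.
- exact: continuous_gauss_fun.
by apply: DeriveDef; [exact: d1 | rewrite -derive1E; exact: d2].
Qed.

Lemma cvg_integral0_gauss : G x @[x --> +oo] --> Num.sqrt pi / 2.
Proof.
have : Num.sqrt (G x ^+ 2) @[x --> +oo] --> Num.sqrt (pi / 4).
  by apply: continuous_cvg;
    [exact: sqrt_continuous|exact: cvg_integral0_gauss_sqr].
rewrite sqrtrM ?pi_ge0// sqrtrV// (_ : 4 = 2 ^+ 2); last by rewrite expr2 -natrM.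
rewrite sqrtr_sqr ger0_norm//.
by under eq_fun do rewrite sqrtr_sqr ger0_norm ?integral0_gauss_ge0//.
Qed.

Lemma cvg0_integral0_gauss : G x @[x --> 0^'+] --> G 0.
Proof.
have G0 : G 0 = 0 by rewrite /integral0_gauss set_itv1 Rintegral_set1.
rewrite G0.
have := @parameterized_integral_cvg_left R 0 1 gauss_fun ltr01.
have i01 : mu.-integrable `[0, 1] (EFin \o gauss_fun).
  by apply: integrableS (@integrableT_gauss R).
move/(_ i01); exact: cvg_at_right_filter.
Qed.

(** From [expR (x ^+ 2) >= (x ^+ 2) ^+ n.+1 / n.+1`!], the product is at most
    [n.+1`! / x] for [x >= 1]. *)
Lemma cvg_expr_gauss n : (x ^+ n * gauss_fun x) @[x --> +oo] --> (0 : R).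
Proof.
apply: (@squeeze_cvgr _ _ _ _ (cst 0) (fun x => n.+1`!%:R * x^-1)); last 2 first.
- exact: cvg_cst.
- rewrite -[X in _ --> X](mulr0 n.+1`!%:R); apply: cvgMr.
  apply/gtr0_cvgV0; last exact: cvg_id.
  exact: nbhs_pinfty_gt.
near=> x.
have x1 : 1 <= x by near: x; exact: nbhs_pinfty_ge.
have x0 : 0 < x by exact: lt_le_trans x1.
apply/andP; split; first by rewrite mulr_ge0 ?exprn_ge0 ?gauss_fun_ge0// ltW.
rewrite /gauss_fun expRN.
rewrite ler_pdivrMr ?expR_gt0// mulrAC ler_pdivlMr// -exprSr.
have := @expR_ge1Dxn R (x ^+ 2) n (sqr_ge0 _).
rewrite -(ler_pM2l (_ : 0 < n.+1`!%:R)) ?ltr0n ?fact_gt0//.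
apply: le_trans; rewrite mulrDr mulrCA divff ?pnatr_eq0 -?lt0n ?fact_gt0//.
rewrite mulr1 -exprM mulSn mul1n addSn addnS.
apply: ler_wpDl => //.
by rewrite mulr1 ler_weXn2l// leqW// ltnS leq_addr.
Unshelve. all: by end_near. Qed.

Lemma is_derive_gauss_fun x : is_derive x 1 (@gauss_fun R) (- (2 * x) * gauss_fun x).
Proof.
rewrite /gauss_fun.
apply: (@is_derive_eq _ _ _ _ _ _ _ _ (@is_derive1_comp _ expR (fun x => - x ^+ 2) _ _ _ _ _)).
rewrite /= scaler1 /GRing.scale/=; ring.
Qed.

Lemma integral0y_gauss2 :
  (\int[mu]_(x in `[0%R, +oo[) (x ^+ 2 * gauss_fun x)%:E)%E = (Num.sqrt pi / 4)%:E.
Proof.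
pose F x : R := 2^-1 * (G x - x ^+ 1 * gauss_fun x).
have dF x : 0 < x -> is_derive x 1 F (x ^+ 2 * gauss_fun x).
  move=> x0; have dg := is_derive_gauss_fun x.
  have dG := is_derive_integral0_gauss x0.
  apply: is_derive_eq.
  by rewrite /GRing.scale/=; field.
rewrite (@ge0_continuous_FTC2y R (fun x => x ^+ 2 * gauss_fun x) F 0 (Num.sqrt pi / 4)).
- rewrite /F -EFinB /integral0_gauss set_itv1 Rintegral_set1; congr EFin; ring.
- by move=> x x0; rewrite mulr_ge0 ?gauss_fun_ge0// sqr_ge0.
- apply: continuous_subspaceT => x.
  by apply: cvgM; [exact: exprn_continuous | exact: continuous_gauss_fun].
- rewrite /F (_ : _ / 4 = 2^-1 * (Num.sqrt pi / 2 - 0)); last by field.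
  by apply: cvgMr; apply: cvgB; [exact: cvg_integral0_gauss | exact: cvg_expr_gauss].
- by move=> x /dF [].
- apply: cvgMr; apply: cvgB; first exact: cvg0_integral0_gauss.
  apply: cvg_at_right_filter; apply: cvgM; first exact: exprn_continuous.
  exact: continuous_gauss_fun.
- by move=> x; rewrite in_itv/= andbT => /dF ?; rewrite derive1E derive_val.
Qed.

Lemma integral0y_gauss4 :
  (\int[mu]_(x in `[0%R, +oo[) (x ^+ 4 * gauss_fun x)%:E)%E =
  (3 * Num.sqrt pi / 8)%:E.
Proof.
pose F x : R := 4^-1 * (3 * (G x - x ^+ 1 * gauss_fun x) - 2 * (x ^+ 3 * gauss_fun x)).
have dF x : 0 < x -> is_derive x 1 F (x ^+ 4 * gauss_fun x).
  move=> x0; have dg := is_derive_gauss_fun x.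
  have dG := is_derive_integral0_gauss x0.
  apply: is_derive_eq.
  by rewrite /GRing.scale/=; field.
rewrite (@ge0_continuous_FTC2y R (fun x => x ^+ 4 * gauss_fun x) F 0 (3 * Num.sqrt pi / 8)).
- rewrite /F -EFinB /integral0_gauss set_itv1 Rintegral_set1; congr EFin; ring.
- by move=> x x0; rewrite mulr_ge0 ?gauss_fun_ge0// exprn_ge0.
- apply: continuous_subspaceT => x.
  by apply: cvgM; [exact: exprn_continuous | exact: continuous_gauss_fun].
- rewrite /F (_ : _ / 8 = 4^-1 * (3 * (Num.sqrt pi / 2 - 0) - 2 * 0)); last by field.
  apply: cvgMr; apply: cvgB; apply: cvgMr; last exact: cvg_expr_gauss.
  by apply: cvgB; [exact: cvg_integral0_gauss | exact: cvg_expr_gauss].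
- by move=> x /dF [].
- have cF n : x ^+ n * gauss_fun x @[x --> 0^'+] --> 0 ^+ n * gauss_fun (0 : R).
    apply: cvg_at_right_filter; apply: cvgM; first exact: exprn_continuous.
    exact: continuous_gauss_fun.
  apply: cvgMr; apply: cvgB; apply: cvgMr; last exact: cF.
  by apply: cvgB; [exact: cvg0_integral0_gauss | exact: cF].
- by move=> x; rewrite in_itv/= andbT => /dF ?; rewrite derive1E derive_val.
Qed.

End gauss_moments.

Section normal_moments.
Context {R : realType}.
Local Notation mu := (@lebesgue_measure R).

(** Two densities of the same measure agree almost everywhere, so the normal
    density may replace the Radon-Nikodym derivative. *)
Lemma ge0_integral_normal_prob (m s : R) (f : R -> \bar R) :
  measurable_fun setT f -> (forall x, 0 <= f x)%E ->
  (\int[normal_prob m s]_x f x = \int[mu]_x (f x * (normal_pdf m s x)%:E))%E.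
Proof.
move=> mf f0; have dom := @normal_prob_dominates R m s.
rewrite -(Radon_Nikodym_SigmaFinite.change_of_variables dom)//.
apply: ae_eq_integral => //.
- apply: emeasurable_funM => //; apply: (measurable_int mu).
  exact: Radon_Nikodym_SigmaFinite.f_integrable.
- apply: emeasurable_funM => //; apply/measurable_EFinP.
  exact: measurable_normal_pdf.
- apply: ae_eqe_mul2l; apply: integral_ae_eq => //.
  + exact: Radon_Nikodym_SigmaFinite.f_integrable.
  + by apply/measurable_EFinP; exact: measurable_normal_pdf.
  + by move=> E _ mE; rewrite -Radon_Nikodym_SigmaFinite.f_integral.
Qed.

(** The substitution [x = m + Num.sqrt (s ^+ 2 *+ 2) * y] turns the normal density
    into the Gaussian function. *)
Lemma ge0_integral_normal_prob_gauss (m s : R) (h : R -> R) : s != 0 ->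
  continuous h -> (forall x, 0 <= h x) ->
  (\int[normal_prob m s]_x (h x)%:E =
   (Num.sqrt pi)^-1%:E *
   \int[mu]_y (h (m + Num.sqrt (s ^+ 2 *+ 2) * y) * gauss_fun y)%:E)%E.
Proof.
move=> s0 ch h0; set c := Num.sqrt (s ^+ 2 *+ 2).
have c0 : 0 < c by rewrite sqrtr_gt0 pmulrn_lgt0// exprn_even_gt0.
have spi0 : 0 < Num.sqrt pi :> R by rewrite sqrtr_gt0 pi_gt0.
pose F (x : R) := (x - m) / c.
have F'E : F^`()%classic = cst c^-1.
  apply/funext => x; rewrite /F derive1E deriveM// deriveD// derive_cst scaler0.
  by rewrite add0r derive_id derive_cst addr0 scaler1.
have ccomp : continuous (fun y => h (m + c * y)).
  move=> y; apply: (@continuous_comp _ _ _ (fun y => m + c * y) h); last exact: ch.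
  by apply: cvgD; [exact: cvg_cst | apply: cvgMr; exact: cvg_id].
rewrite (@increasing_ge0_integration_by_substitutionT R F
  (fun y => h (m + c * y) * gauss_fun y)); last 9 first.
- by move=> x y xy; rewrite /F ltr_pM2r ?invr_gt0// ltrD2r.
- by rewrite F'E => ?; exact: cvg_cst.
- by rewrite F'E; exact: is_cvg_cst.
- by rewrite F'E; exact: is_cvg_cst.
- by [].
- by apply/gt0_cvgMlNy; [rewrite invr_gt0 | exact: cvg_addrr_Ny].
- by apply/gt0_cvgMly; [rewrite invr_gt0 | exact: cvg_addrr].
- by move=> y; apply: cvgM; [exact: ccomp | exact: continuous_gauss_fun].
- by move=> y; rewrite mulr_ge0 ?h0// gauss_fun_ge0.
have mh : measurable_fun setT h by exact: continuous_measurable_fun.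
rewrite ge0_integral_normal_prob//; last exact/measurable_EFinP.
rewrite -ge0_integralZl//; first last.
- move=> x _; rewrite lee_fin F'E !fctE !mulr_ge0 ?h0 ?gauss_fun_ge0//.
  by rewrite invr_ge0 ltW.
- apply/measurable_EFinP; apply: continuous_measurable_fun => x.
  rewrite F'E; apply: cvgM; last exact: cvg_cst.
  have cF : {for x, continuous F}.
    by apply: cvgM; [apply: cvgB; [exact: cvg_id | exact: cvg_cst] | exact: cvg_cst].
  apply: cvgM.
    by apply: (@continuous_comp _ _ _ F (fun y => h (m + c * y))) => //; exact: ccomp.
  by apply: (@continuous_comp _ _ _ F gauss_fun) => //; exact: continuous_gauss_fun.
apply: eq_integral => x _; rewrite -!EFinM; congr EFin.
rewrite F'E normal_pdfE// !fctE/= /F.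
rewrite (mulrC c) divfK ?gt_eqF// addrC subrK.
rewrite /normal_peak /normal_fun /gauss_fun.
rewrite (_ : - (x - m) ^+ 2 / (s ^+ 2 *+ 2) = - ((x - m) / c) ^+ 2); last first.
  by rewrite expr_div_n sqr_sqrtr ?mulNr// mulrn_wge0// sqr_ge0.
rewrite (_ : s ^+ 2 * pi *+ 2 = s ^+ 2 *+ 2 * pi); last by rewrite mulrnAl.
rewrite sqrtrM ?mulrn_wge0 ?sqr_ge0// -/c invfM; ring.
Qed.

Lemma integralT_expr_gauss n : ~~ odd n ->
  (\int[mu]_x (x ^+ n * gauss_fun x)%:E =
   2%:E * \int[mu]_(x in `[0%R, +oo[) (x ^+ n * gauss_fun x)%:E)%E.
Proof.
move=> en; rewrite ge0_symfun_integralT//.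
- by congr (_ * _)%E; congr integral; apply/seteqP; split => x/=; rewrite in_itv/= andbT.
- by move=> x; rewrite mulr_ge0 ?gauss_fun_ge0// exprn_even_ge0.
- by move=> x; apply: cvgM; [exact: exprn_continuous | exact: continuous_gauss_fun].
- by move=> x /=; rewrite /gauss_fun sqrrN -[- x]mulN1r exprMn -signr_odd (negbTE en) mul1r.
Qed.

Lemma normal_prob_central_even (m s : R) n : s != 0 -> ~~ odd n ->
  (\int[normal_prob m s]_x ((x - m) ^+ n)%:E =
   (Num.sqrt pi)^-1%:E * ((Num.sqrt (s ^+ 2 *+ 2) ^+ n)%:E *
    (2%:E * \int[mu]_(x in `[0%R, +oo[) (x ^+ n * gauss_fun x)%:E)))%E.
Proof.
move=> s0 en; have h0 x : 0 <= (x - m) ^+ n by exact: exprn_even_ge0.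
have ch : continuous (fun x : R => (x - m) ^+ n).
  move=> x; apply: (@continuous_comp _ _ _ (fun x => x - m) (fun x => x ^+ n)).
    by apply: cvgB; [exact: cvg_id | exact: cvg_cst].
  exact: exprn_continuous.
rewrite ge0_integral_normal_prob_gauss// -integralT_expr_gauss//.
rewrite -[in RHS]ge0_integralZl//; first last.
- by move=> x _; rewrite lee_fin mulr_ge0 ?gauss_fun_ge0// exprn_even_ge0.
- apply/measurable_EFinP; apply: continuous_measurable_fun => x.
  by apply: cvgM; [exact: exprn_continuous | exact: continuous_gauss_fun].
congr (_ * _)%E; apply: eq_integral => x _; rewrite -EFinM; congr EFin.
by rewrite addrAC subrr add0r exprMn mulrA.
Qed.

Lemma normal_prob_moment2 (m s : R) : s != 0 ->
  (\int[normal_prob m s]_x ((x - m) ^+ 2)%:E = (s ^+ 2)%:E)%E.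
Proof.
move=> s0; rewrite normal_prob_central_even// integral0y_gauss2 -!EFinM; congr EFin.
rewrite sqr_sqrtr ?mulrn_wge0 ?sqr_ge0//; field.
by rewrite gt_eqF// sqrtr_gt0 pi_gt0.
Qed.

Lemma normal_prob_moment4 (m s : R) : s != 0 ->
  (\int[normal_prob m s]_x ((x - m) ^+ 4)%:E = (3 * s ^+ 4)%:E)%E.
Proof.
move=> s0; rewrite normal_prob_central_even// integral0y_gauss4 -!EFinM; congr EFin.
rewrite (exprM _ 2 2) sqr_sqrtr ?mulrn_wge0 ?sqr_ge0//; field.
by rewrite gt_eqF// sqrtr_gt0 pi_gt0.
Qed.

Lemma ge0_integralT_half_lines (h : R -> R) : continuous h -> (forall x, 0 <= h x) ->
  (\int[mu]_x (h x)%:E = \int[mu]_(x in `[0%R, +oo[) (h (- x))%:E +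
   \int[mu]_(x in `[0%R, +oo[) (h x)%:E)%E.
Proof.
move=> ch h0; have mh : measurable_fun setT h by exact: continuous_measurable_fun.
have -> : [set: R] = `]-oo, (- 0)] `|` `]0, +oo[.
  by apply/seteqP; split => x //= _; rewrite !in_itv/= oppr0 andbT; case: (leP x 0) => _; [left|right].
rewrite ge0_integral_setU//=; last 3 first.
- by apply/measurable_EFinP; apply: measurable_funS mh.
- by move=> x _; rewrite lee_fin.
- by apply/disj_setPLR => x /=; rewrite !in_itv/= oppr0 andbT => x0; apply/negP; rewrite -leNgt.
rewrite ge0_integration_by_substitutionNy//; last exact: continuous_subspaceT.
by rewrite integral_itv_obnd_cbnd//; apply/measurable_EFinP; apply: measurable_funS mh.
Qed.

Lemma ge0_integralT_oppr (h : R -> R) : continuous h -> (forall x, 0 <= h x) ->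
  (\int[mu]_x (h x)%:E = \int[mu]_x (h (- x))%:E)%E.
Proof.
move=> ch h0.
have chN : continuous (h \o -%R).
  by move=> x; apply: (@continuous_comp _ _ _ -%R h); [exact: opp_continuous | exact: ch].
rewrite ge0_integralT_half_lines// (@ge0_integralT_half_lines (h \o -%R))//= addeC.
by under [X in (X + _)%E = _]eq_integral do rewrite -[x in h x]opprK.
Qed.

(** Both integrands are nonnegative, so this is the symmetry of the normal law
    around [m] in a form that does not presuppose integrability; it identifies
    [m] as the mean. *)
Lemma normal_prob_symmetric (m s : R) : s != 0 ->
  (\int[normal_prob m s]_x (`|x - m| + (x - m))%:E =
   \int[normal_prob m s]_x (`|x - m| - (x - m))%:E)%E.
Proof.
move=> s0.
have cB : continuous (fun x : R => x - m).
  by move=> x; apply: cvgB; [exact: cvg_id | exact: cvg_cst].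
have cN : continuous (fun x : R => `|x - m|).
  by move=> x; apply: cvg_norm; exact: cB.
rewrite !ge0_integral_normal_prob_gauss//; last 4 first.
- by move=> x; apply: cvgB; [exact: cN | exact: cB].
- by move=> x; rewrite subr_ge0 ler_norm.
- by move=> x; apply: cvgD; [exact: cN | exact: cB].
- by move=> x; rewrite -[x - m]opprK opprK -lerBlDr sub0r -normrN ler_norm.
have E c y : m + c * y - m = c * y by rewrite addrAC subrr add0r.
have cg (c : R) : continuous (fun y : R => m + c * y - m).
  by under eq_fun do rewrite E; move=> y; apply: cvgMr; exact: cvg_id.
congr (_ * _)%E; rewrite ge0_integralT_oppr; last 2 first.
- move=> y; apply: cvgM; last exact: continuous_gauss_fun.
  by apply: cvgD; [apply: cvg_norm; exact: cg | exact: cg].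
- move=> y; rewrite mulr_ge0 ?gauss_fun_ge0// -lerBlDr sub0r -normrN.
  exact: ler_norm.
apply: eq_integral => x _; rewrite /gauss_fun sqrrN; congr (_ * _)%:E.
by rewrite !E mulrN normrN.
Qed.

End normal_moments.

(** * Moments of Gaussian random variables *)

Section gaussian_moments.
Context {R : realType} {disp : measure_display} {Omega : measurableType disp}.
Variable P : probability Omega R.
Implicit Types (Y Z f g : Omega -> R).

Definition pint f := P.-integrable setT (EFin \o f).
Definition mean f : R := \int[P]_w f w.

Lemma ge0_integral_gaussian_law Y (m s : R) :
  measurable_fun setT Y ->
  (forall A : set R, measurable A -> P (Y @^-1` A) = gaussian_law m s A) ->
  forall h : R -> R, measurable_fun setT h -> (forall x, 0 <= h x) ->
  (\int[P]_w (h (Y w))%:E =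
   if (s == 0)%R then (h m)%:E else \int[normal_prob m s]_x (h x)%:E)%E.
Proof.
move=> mY law h mh h0.
have mEh : measurable_fun setT (EFin \o h) by exact/measurable_EFinP.
have -> : (\int[P]_w (h (Y w))%:E = \int[pushforward P (Y : Omega -> measurableTypeR R)]_x (h x)%:E)%E.
  by rewrite ge0_integral_pushforward// => y _; rewrite lee_fin.
move: law; rewrite /gaussian_law; have [_|s0] := eqVneq s 0 => law.
  rewrite (eq_measure_integral (\d_(m : measurableTypeR R) : measure _ R)); last first.
    by move=> A mA _; exact: (law _ mA).
  by rewrite integral_dirac// diracT mul1e.
by apply: (@eq_measure_integral _ (measurableTypeR R)) => A mA _; exact: (law _ mA).
Qed.

Lemma gaussian_rv_central_moments Y : gaussian_rv P Y ->
  exists m s : R,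
  [/\ (\int[P]_w (`|Y w - m| + (Y w - m))%:E =
       \int[P]_w (`|Y w - m| - (Y w - m))%:E)%E,
      (\int[P]_w ((Y w - m) ^+ 2)%:E = (s ^+ 2)%:E)%E &
      (\int[P]_w ((Y w - m) ^+ 4)%:E = (3 * s ^+ 4)%:E)%E].
Proof.
move=> [mY [m [s law]]]; exists m, s.
have tr := ge0_integral_gaussian_law mY law.
have mB : measurable_fun setT (fun x : R => x - m) by exact: measurable_funB.
have mN : measurable_fun setT (fun x : R => `|x - m|) by exact: measurableT_comp.
split.
- rewrite (tr (fun x => `|x - m| + (x - m))); last 2 first.
  + exact: measurable_funD.
  + by move=> x; rewrite -lerBlDr sub0r -normrN ler_norm.
  rewrite (tr (fun x => `|x - m| - (x - m))); last 2 first.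
  + exact: measurable_funB.
  + by move=> x; rewrite subr_ge0 ler_norm.
  have [_|s0] := eqVneq s 0; first by rewrite subrr normr0 addr0 subr0.
  exact: normal_prob_symmetric.
- rewrite (tr (fun x => (x - m) ^+ 2)); last 2 first.
  + exact: measurable_funX.
  + by move=> x; rewrite sqr_ge0.
  have [->|s0] := eqVneq s 0; first by rewrite subrr.
  exact: normal_prob_moment2.
- rewrite (tr (fun x => (x - m) ^+ 4)); last 2 first.
  + exact: measurable_funX.
  + by move=> x; rewrite exprn_even_ge0.
  have [->|s0] := eqVneq s 0; first by rewrite subrr expr0n mulr0.
  exact: normal_prob_moment4.
Qed.

Lemma pint_le f g : measurable_fun setT f -> pint g ->
  (forall w, `|f w| <= `|g w|) -> pint f.
Proof.
move=> mf ig fg; apply: (le_integrable measurableT _ _ ig) => //.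
- exact/measurable_EFinP.
- by move=> w _; rewrite /= lee_fin.
Qed.

Lemma pint_measurable f : pint f -> measurable_fun setT f.
Proof. by case/integrableP => /measurable_EFinP. Qed.

Lemma pint_cst c : pint (cst c).
Proof.
exact: finite_measure_integrable_cst.
Qed.

Lemma pintD f g : pint f -> pint g -> pint (fun w => f w + g w).
Proof. by move=> pf pg; exact: (integrableD measurableT pf pg). Qed.

Lemma pintZ c f : pint f -> pint (fun w => c * f w).
Proof. by move=> pf; exact: (integrableZl measurableT c pf). Qed.

Lemma pint_sum I (r : seq I) (Q : pred I) (F : I -> Omega -> R) :
  (forall i, Q i -> pint (F i)) -> pint (fun w => \sum_(i <- r | Q i) F i w).
Proof.
move=> pF; elim: r => [|i r IH].
  by under eq_fun do rewrite big_nil; exact: pint_cst.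
under eq_fun do rewrite big_cons.
by have [Qi|//] := boolP (Q i); apply: pintD => //; exact: pF.
Qed.

Lemma mean_cst c : mean (cst c) = c.
Proof. 
rewrite /mean Rintegral_cst// (_ : fine _ = 1) ?mulr1//.
exact: (congr1 fine (probability_setT P)).
Qed.

Lemma meanD f g : pint f -> pint g ->
  mean (fun w => f w + g w) = mean f + mean g.
Proof. by move=> pf pg; exact: RintegralD. Qed.

Lemma meanZ c f : pint f -> mean (fun w => c * f w) = c * mean f.
Proof. by move=> pf; exact: RintegralZl. Qed.

Lemma mean_sum I (r : seq I) (Q : pred I) (F : I -> Omega -> R) :
  (forall i, Q i -> pint (F i)) ->
  mean (fun w => \sum_(i <- r | Q i) F i w) = \sum_(i <- r | Q i) mean (F i).
Proof.
move=> pF; elim: r => [|i r IH].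
  by under eq_fun do rewrite big_nil; rewrite big_nil; exact: mean_cst.
under eq_fun do rewrite big_cons.
rewrite big_cons; have [Qi|//] := boolP (Q i).
by rewrite meanD ?IH//; [exact: pF | exact: pint_sum].
Qed.

Lemma mean_EFin f : pint f -> (\int[P]_w (f w)%:E = (mean f)%:E)%E.
Proof. by move=> pf; rewrite /mean /Rintegral fineK//; exact: integrable_fin_num. Qed.

Lemma ge0_pint f (c : R) : measurable_fun setT f -> (forall w, 0 <= f w) ->
  (\int[P]_w (f w)%:E = c%:E)%E -> pint f /\ mean f = c.
Proof.
move=> mf f0 fc; split; last by rewrite /mean /Rintegral fc.
apply/integrableP; split; first exact/measurable_EFinP.
by under eq_integral do rewrite /= ger0_norm//; rewrite fc ltry.
Qed.

(** What is used of a centered Gaussian variable, degenerate or not: its fourth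
    moment is finite and determined by its variance. *)
Definition gaussian_like Y := [/\ measurable_fun setT Y, pint (fun w => Y w ^+ 4) &
   mean (fun w => Y w ^+ 4) = 3 * mean (fun w => Y w ^+ 2) ^+ 2].

Lemma pint_expr4 Y k : measurable_fun setT Y -> pint (fun w => Y w ^+ 4) ->
  (k <= 4)%N -> pint (fun w => Y w ^+ k).
Proof.
move=> mY Y4 k4.
apply: (@pint_le _ (fun w => 1 + Y w ^+ 4)).
- exact: measurable_funX.
- by apply: pintD => //; exact: pint_cst.
- move=> w; rewrite [X in _ <= X]ger0_norm; last by rewrite addr_ge0// exprn_even_ge0.
  have -> : Y w ^+ 4 = `|Y w| ^+ 4 by rewrite -normrX ger0_norm// exprn_even_ge0.
  rewrite normrX; have [Y1|/ltW Y1] := leP `|Y w| 1.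
    by rewrite (le_trans (exprn_ile1 _ _ _))// lerDl exprn_ge0.
  by rewrite (le_trans (ler_weXn2l Y1 k4))// lerDr.
Qed.

(** The parameter [m] of the law is the mean by symmetry, hence vanishes. *)
Lemma centered_gaussian_like Y : gaussian_rv P Y -> ('E_P[Y] = 0)%E ->
  gaussian_like Y.
Proof.
move=> gY EY; have [mY _] := gY.
have [m [s [sym m2 m4]]] := gaussian_rv_central_moments gY.
have mB : measurable_fun setT (fun w => Y w - m) by exact: measurable_funB.
have [p2 e2] := ge0_pint (measurable_funX 2 mB) (fun w => sqr_ge0 _) m2.
have [p4 e4] := ge0_pint (measurable_funX 4 mB) (fun w => @exprn_even_ge0 R 4 _ isT) m4.
have p1 : pint (fun w => Y w - m) := pint_expr4 mB p4 (isT : (1 <= 4)%N).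
have pn : pint (fun w => `|Y w - m|).
  by apply: pint_le p1 _; [exact: measurableT_comp | move=> w; rewrite normr_id].
have EB : mean (fun w => Y w - m) = 0.
  have p1N := pintZ (-1) p1.
  have : mean (fun w => `|Y w - m| + (Y w - m)) =
         mean (fun w => `|Y w - m| + -1 * (Y w - m)).
    rewrite {1}/mean /Rintegral sym; congr fine.
    by apply: eq_integral => w _; rewrite mulN1r.
  rewrite (meanD pn p1) (meanD pn p1N) (meanZ _ p1); lra.
have EY0 : mean Y = 0 by move: EY; rewrite unlock /mean /Rintegral => ->.
have m0 : m = 0.
  move: EB; rewrite (_ : mean _ = mean (fun w => (Y w - m) + m) - m).
    by under [mean _]eq_Rintegral do rewrite subrK; rewrite -/(mean Y) EY0; lra.
  rewrite (meanD p1 (pint_cst m)) -[LHS](addrK m); congr (_ + _ - _).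
  exact/esym/mean_cst.
have YE k : (fun w => (Y w - m) ^+ k) = (fun w => Y w ^+ k).
  by apply/funext => w; rewrite m0 subr0.
rewrite !YE in e2 p4 e4.
split => //; rewrite e4 e2; ring.
Qed.

End gaussian_moments.

(** * Weak law of large numbers for weakly correlated Gaussian variables *)

Section weak_law.
Context {R : realType} {disp : measure_display} {Omega : measurableType disp}.
Variable P : probability Omega R.
Implicit Types (U V : Omega -> R).
Local Notation pint := (pint P).
Local Notation mean := (mean P).

(** The products [U * V] and [U ^+ 2 * V ^+ 2] are combinations of second and
    fourth powers of linear combinations of [U] and [V], whose fourth moments are
    known. *)
Lemma gaussian_like_pair U V :
  (forall a : bool -> R, gaussian_like P (fun w => a true * U w + a false * V w)) ->
  [/\ pint (fun w => U w * V w), pint (fun w => U w ^+ 2 * V w ^+ 2) &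
   mean (fun w => U w ^+ 2 * V w ^+ 2) =
   mean (fun w => U w ^+ 2) * mean (fun w => V w ^+ 2) +
   2 * mean (fun w => U w * V w) ^+ 2].
Proof.
move=> gUV.
have gl x y : gaussian_like P (fun w => x * U w + y * V w).
  exact: (gUV (fun b => if b then x else y)).
have M4 x y := let: And3 _ _ e := gl x y in e.
have p4 x y := let: And3 _ p _ := gl x y in p.
have p2 x y : pint (fun w => (x * U w + y * V w) ^+ 2).
  by have [m p _] := gl x y; exact: pint_expr4 m p _.
have EU k : (fun w => U w ^+ k) = (fun w => (1 * U w + 0 * V w) ^+ k).
  by apply/funext => w; rewrite mul1r mul0r addr0.
have EV k : (fun w => V w ^+ k) = (fun w => (0 * U w + 1 * V w) ^+ k).
  by apply/funext => w; rewrite mul1r mul0r add0r.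
have EUV : (fun w => U w * V w) = (fun w =>
    4^-1 * (1 * U w + 1 * V w) ^+ 2 + - 4^-1 * (1 * U w + - 1 * V w) ^+ 2).
  by apply/funext => w; field.
have E22 : (fun w => U w ^+ 2 * V w ^+ 2) = (fun w =>
    (12^-1 * (1 * U w + 1 * V w) ^+ 4 + 12^-1 * (1 * U w + - 1 * V w) ^+ 4) +
    (- 6^-1 * (1 * U w + 0 * V w) ^+ 4 + - 6^-1 * (0 * U w + 1 * V w) ^+ 4)).
  by apply/funext => w; field.
have EP : (fun w => 2 * (1 * U w + 0 * V w) ^+ 2 + 2 * (0 * U w + 1 * V w) ^+ 2) =
    (fun w => (1 * U w + 1 * V w) ^+ 2 + (1 * U w + - 1 * V w) ^+ 2).
  by apply/funext => w; ring.
split.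
- by rewrite EUV; apply: pintD; apply: pintZ.
- by rewrite E22; apply: pintD; apply: pintD; apply: pintZ.
have par := congr1 mean EP.
have par' : 2 * mean (fun w => (1 * U w + 0 * V w) ^+ 2) +
    2 * mean (fun w => (0 * U w + 1 * V w) ^+ 2) =
    mean (fun w => (1 * U w + 1 * V w) ^+ 2) +
    mean (fun w => (1 * U w + - 1 * V w) ^+ 2).
  by move: par; rewrite !meanD ?meanZ//; exact: pintZ.
rewrite EUV E22 EU EV.
rewrite meanD; [| by apply: pintD; exact: pintZ..].
rewrite !meanD; [|exact: pintZ..].
rewrite !meanZ// !M4.
move: par'; set a := mean (fun w => (1 * U w + 0 * _) ^+ 2).
set b := mean _; set p := mean (fun w => (1 * U w + 1 * _) ^+ 2).
set q := mean _ => par'.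
have -> : q = 2 * a + 2 * b - p by rewrite par'; ring.
by field.
Qed.

(** The second moments of the sums of the [b j] and of the [b j ^+ 2 - 1] are
    double sums of [rho j k] and [2 * rho j k ^+ 2], both controlled by
    [sum_rho]; they grow linearly in [N], whereas sums of totally correlated
    variables would grow quadratically. *)
Section system.
Variables (N : nat) (b : 'I_N -> Omega -> R).
Hypothesis N0 : (0 < N)%N.
Hypothesis gb : forall a : 'I_N -> R, gaussian_like P (fun w => \sum_j a j * b j w).
Hypothesis b1 : forall j, mean (fun w => b j w ^+ 2) = 1.
Hypothesis bN : forall j k, j != k -> `|mean (fun w => b j w * b k w)| <= N%:R^-1.

Let Nr0 : 0 < N%:R :> R. Proof. by rewrite ltr0n. Qed.

Let gb1 (j : 'I_N) : gaussian_like P (b j).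
Proof.
have := gb (fun k => (k == j)%:R).
rewrite (_ : (fun w => _) = b j)//; apply/funext => w.
rewrite (bigD1 j)//= eqxx mul1r big1 ?addr0// => k /negbTE ->; exact: mul0r.
Qed.

Let gb2 (j k : 'I_N) (a : bool -> R) :
  gaussian_like P (fun w => a true * b j w + a false * b k w).
Proof.
have := gb (fun i => a true * (i == j)%:R + a false * (i == k)%:R).
rewrite (_ : (fun w => _) = (fun w => a true * b j w + a false * b k w))//.
apply/funext => w; under eq_bigr do rewrite mulrDl -!mulrA.
rewrite big_split/= -!mulr_sumr; congr (_ * _ + _ * _).
  by rewrite (bigD1 j)//= eqxx mul1r big1 ?addr0// => i /negbTE ->; exact: mul0r.
by rewrite (bigD1 k)//= eqxx mul1r big1 ?addr0// => i /negbTE ->; exact: mul0r.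
Qed.

Local Notation rho j k := (mean (fun w => b j w * b k w)).

Let sum_rho : \sum_j \sum_k `|rho j k| <= 2 * N%:R.
Proof.
rewrite [leRHS](_ : _ = \sum_(j < N) 2); last first.
  by rewrite sumr_const card_ord mulr_natr.
apply: ler_sum => j _; rewrite (bigD1 j)//= (_ : rho j j = 1); last first.
  by rewrite -(b1 j); congr mean; apply/funext => w; rewrite expr2.
rewrite normr1 (_ : 2 = 1 + 1 :> R); last by ring.
rewrite lerD2l (@le_trans _ _ (\sum_(k < N | k != j) N%:R^-1))//.
  by apply: ler_sum => k kj; apply: bN; rewrite eq_sym.
rewrite (@le_trans _ _ (\sum_(k < N) N%:R^-1))//.
  by rewrite [leRHS](bigD1 j)//= lerDr invr_ge0 ltW.
by rewrite sumr_const card_ord -[X in X <= _]mulr_natr mulVf// gt_eqF.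
Qed.

Let mean_sqr_sum (f : 'I_N -> Omega -> R) :
  (forall j k, pint (fun w => f j w * f k w)) ->
  pint (fun w => (\sum_j f j w) ^+ 2) /\
  mean (fun w => (\sum_j f j w) ^+ 2) = \sum_j \sum_k mean (fun w => f j w * f k w).
Proof.
move=> pf.
have -> : (fun w => (\sum_j f j w) ^+ 2) = (fun w => \sum_j \sum_k f j w * f k w).
  by apply/funext => w; rewrite expr2 big_distrlr.
split; first by apply: pint_sum => j _; apply: pint_sum.
rewrite mean_sum; last by move=> ? _; apply: pint_sum.
by apply: eq_bigr => j _; rewrite mean_sum.
Qed.

Lemma mean_sqr_sum_le :
  pint (fun w => (\sum_j b j w) ^+ 2) /\
  mean (fun w => (\sum_j b j w) ^+ 2) <= 2 * N%:R.
Proof.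
have [|p ->] := @mean_sqr_sum b.
  by move=> j k; have [] := gaussian_like_pair (gb2 j k).
split=> //; apply: le_trans sum_rho.
by apply: ler_sum => j _; apply: ler_sum => k _; exact: ler_norm.
Qed.

Lemma mean_sqr_dev_le :
  pint (fun w => (\sum_j (b j w ^+ 2 - 1)) ^+ 2) /\
  mean (fun w => (\sum_j (b j w ^+ 2 - 1)) ^+ 2) <= 4 * N%:R.
Proof.
have p2 j : pint (fun w => b j w ^+ 2) by have [m p _] := gb1 j; exact: pint_expr4 m p _.
have Ef j k : (fun w => (b j w ^+ 2 - 1) * (b k w ^+ 2 - 1)) =
    (fun w => (b j w ^+ 2 * b k w ^+ 2 + cst 1 w) + (-1 * b j w ^+ 2 + -1 * b k w ^+ 2)).
  by apply/funext => w /=; ring.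
have pf j k : pint (fun w => (b j w ^+ 2 - 1) * (b k w ^+ 2 - 1)).
  have [_ p _] := gaussian_like_pair (gb2 j k).
  by rewrite Ef; apply: pintD; apply: pintD; rewrite ?pint_cst//; apply: pintZ.
have [|p ->] := @mean_sqr_sum (fun j w => b j w ^+ 2 - 1); first exact: pf.
split => //.
have -> : 4 * N%:R = 2 * (2 * N%:R) :> R by ring.
apply: le_trans (ler_wpM2l _ sum_rho) => //.
rewrite mulr_sumr; apply: ler_sum => j _; rewrite mulr_sumr; apply: ler_sum => k _.
have [pjk p22 e22] := gaussian_like_pair (gb2 j k).
have p1 : pint (cst 1) by exact: pint_cst.
rewrite Ef meanD; [|by apply: pintD|by apply: pintD; exact: pintZ].
rewrite (meanD p22 p1) meanD; [|exact: pintZ..].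
rewrite !meanZ// [mean (fun w => cst 1 w)]mean_cst e22 !b1.
rewrite (_ : _ + _ + _ = 2 * rho j k ^+ 2); last by ring.
apply: ler_wpM2l => //; rewrite -(real_normK (num_real _)) expr2 ler_piMr//.
have [->|jk] := eqVneq j k.
  by under eq_fun do rewrite -expr2; rewrite b1 normr1.
by apply: le_trans (bN jk) _; rewrite invf_le1// ler1n.
Qed.

Lemma mean_expr4 j : pint (fun w => b j w ^+ 4) /\ mean (fun w => b j w ^+ 4) = 3.
Proof. by have [_ p ->] := gb1 j; rewrite b1; split => //; ring. Qed.

End system.

End weak_law.

(** * Scalar fractional Brownian motion at widely separated times *)

Section fbm_covariance.
Context {R : realType}.
Implicit Types (H t s x : R).

Lemma fbm_cov_diag H t : 0 < H -> fbm_cov H t t = t `^ (2 * H).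
Proof.
move=> H0; rewrite /fbm_cov subrr normr0 powR0 ?subr0; first by field.
by rewrite mulf_neq0// gt_eqF.
Qed.

Lemma powR_small (a e : R) : 0 < a -> 0 < e ->
  forall x, 0 <= x <= e `^ a^-1 -> x `^ a <= e.
Proof.
move=> a0 e0 x /andP[x0 xe].
rewrite [leRHS](_ : e = (e `^ a^-1) `^ a); last first.
  by rewrite -powRrM mulVf ?gt_eqF// powRr1// ltW.
by rewrite ge0_ler_powR ?nnegrE ?powR_ge0// ltW.
Qed.

(** With [x = s / t], the covariance divided by [t `^ H * s `^ H] is
    (1 - (1 - x)^(2H) + x^(2H)) / (2 x^H), which is at most
    (2 x^(1-H) + x^H) / 2 because (1 - x)^(2H) >= (1 - x)^2 >= 1 - 2 x; it tends
    to 0 with [x] precisely because 0 < H < 1. *)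
Lemma fbm_cov_small H (e : R) : 0 < H -> H < 1 -> 0 < e ->
  exists theta : R, [/\ 0 < theta, theta < 1 & forall t s, 0 < t -> 0 < s ->
    s <= theta * t -> `|fbm_cov H t s| <= e * (t `^ H * s `^ H)].
Proof.
move=> H0 H1 e0; have H10 : 0 < 1 - H by rewrite subr_gt0.
have e20 : 0 < e / 2 by rewrite divr_gt0.
exists (Num.min 2^-1 (Num.min (e `^ H^-1) ((e / 2) `^ (1 - H)^-1))); split.
- by rewrite !lt_min invr_gt0 ltr0n !powR_gt0.
- by rewrite gt_min invf_lt1// ltr1n.
move=> t s t0 s0; rewrite -ler_pdivrMr// !le_min => /and3P[x2 xH xH1].
set x := s / t in x2 xH xH1; have x0 : 0 < x by rewrite divr_gt0.
have -> : s = x * t by rewrite /x divfK// gt_eqF.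
clearbody x.
have x1 : 0 <= 1 - x by rewrite subr_ge0 (le_trans x2)// invf_le1// ler1n.
have x1' : 0 < 1 - x <= 1.
  rewrite subr_gt0 lerBlDr lerDl (ltW x0) andbT (le_lt_trans x2)//.
  by rewrite invf_lt1// ltr1n.
have t1 : 0 <= t := ltW t0; have x0' := ltW x0.
have sq : t `^ (2 * H) = t `^ H * t `^ H.
  by rewrite (_ : 2 * H = H + H) ?powRD//; [rewrite (gt_eqF t0) implybT | ring].
have xq : x `^ (2 * H) = x `^ H * x `^ H.
  by rewrite (_ : 2 * H = H + H) ?powRD//; [rewrite (gt_eqF x0) implybT | ring].
have xd : x = x `^ H * x `^ (1 - H).
  rewrite -powRD; last by rewrite (gt_eqF x0) implybT.
  by rewrite addrC subrK powRr1.
have e1 : x `^ H <= e by apply: powR_small; rewrite // x0'.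
have e2 : x `^ (1 - H) <= e / 2 by apply: powR_small; rewrite // x0'.
have l1 : (1 - x) `^ (2 * H) <= 1.
  rewrite [leRHS](_ : 1 = 1 `^ (2 * H)); last by rewrite powR1.
  by rewrite ge0_ler_powR ?nnegrE//; [rewrite mulr_ge0// ltW | case/andP: x1'].
have l2 : 1 - 2 * x <= (1 - x) `^ (2 * H).
  apply: (@le_trans _ _ ((1 - x) ^+ 2)).
    by rewrite -subr_ge0 (_ : _ - _ = x ^+ 2) ?sqr_ge0//; ring.
  rewrite -powR_mulrn//; apply: ger_powR => //.
  by rewrite -[leRHS]mulr1 ler_pM2l// ltW.
have -> : fbm_cov H t (x * t) =
    2^-1 * (t `^ H * t `^ H) * (1 - (1 - x) `^ (2 * H) + x `^ H * x `^ H).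
  rewrite /fbm_cov (_ : t - x * t = (1 - x) * t); last by ring.
  rewrite ger0_norm ?mulr_ge0// !powRM// sq xq; ring.
rewrite powRM// ger0_norm; last first.
  by apply: mulr_ge0; [rewrite !mulr_ge0 ?powR_ge0 | rewrite addr_ge0 ?subr_ge0// mulr_ge0 ?powR_ge0].
rewrite [leRHS](_ : _ = t `^ H * t `^ H * (e * x `^ H)); last by ring.
rewrite [leLHS](_ : _ = t `^ H * t `^ H *
    (((1 - (1 - x) `^ (2 * H)) + x `^ H * x `^ H) / 2)); last by ring.
rewrite ler_pM2l; last by rewrite mulr_gt0// powR_gt0.
rewrite ler_pdivrMr//.
apply: (@le_trans _ _ (2 * x + x `^ H * x `^ H)).
  by rewrite lerD2r lerBlDr -lerBlDl.
rewrite [X in 2 * X + _]xd.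
rewrite (_ : _ + _ = (2 * x `^ (1 - H) + x `^ H) * x `^ H); last by ring.
rewrite (_ : e * _ * 2 = (e + e) * x `^ H); last by ring.
rewrite ler_pM2r ?powR_gt0// lerD// mulrC -ler_pdivlMr//.
Qed.

End fbm_covariance.

Section gaussian_families.
Context {R : realType} {disp : measure_display} {Omega : measurableType disp}.
Variable P : probability Omega R.
Context {I : Type} (D : set I) (Y : I -> Omega -> R).
Hypothesis gY : gaussian_family P D Y.
Hypothesis cY : centered_family P D Y.

Let gaussian_like1 i : D i -> gaussian_like P (Y i).
Proof.
move=> Di; apply: centered_gaussian_like; last exact: cY.
have := @gY 1 (fun=> i) (fun=> 1) (fun=> Di).
by under eq_fun do rewrite big_ord1 mul1r.
Qed.

Lemma gaussian_family_lincomb k (i : 'I_k -> I) (a : 'I_k -> R) :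
  (forall j, D (i j)) -> gaussian_like P (fun w => \sum_(j < k) a j * Y (i j) w).
Proof.
move=> Di; have p1 j : pint P (Y (i j)).
  by have [m p _] := gaussian_like1 (Di j); exact: (pint_expr4 m p (isT : (1 <= 4)%N)).
apply: centered_gaussian_like; first exact: gY.
rewrite unlock mean_EFin; last by apply: pint_sum => j _; exact: pintZ.
rewrite mean_sum; last by move=> j _; exact: pintZ.
rewrite big1// => j _; rewrite meanZ//.
by have := cY (Di j); rewrite unlock /mean /Rintegral => ->; rewrite mulr0.
Qed.

Lemma gaussian_family_pair i j : D i -> D j -> forall a : bool -> R,
  gaussian_like P (fun w => a true * Y i w + a false * Y j w).
Proof.
move=> Di Dj a; have := @gaussian_family_lincomb 2
  (fun k => if k == 0 then i else j) (fun k => a (k == 0)).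
under eq_fun do rewrite 2!big_ord_recl big_ord0 addr0 /=.
by apply=> k; case: ifP.
Qed.

Lemma centered_covariance i j : D i -> D j ->
  fine (covariance P (Y i) (Y j)) = mean P (fun w => Y i w * Y j w).
Proof.
move=> Di Dj; rewrite covariance.unlock !cY//= expectation.unlock.
by congr fine; apply: eq_integral => w _; rewrite !fctE /= !subr0.
Qed.

End gaussian_families.

Section fbm_process.
Context {R : realType} {disp : measure_display} {Omega : measurableType disp}.
Variable P : probability Omega R.
Variables (H : R) (B : R -> Omega -> R).
Hypothesis fB : standard_fbm P H B.

Lemma fbm_meanM t s : 0 <= t -> 0 <= s ->
  mean P (fun w => B t w * B s w) = fbm_cov H t s.
Proof.
move=> t0 s0; have [_ cB covB] := fB.
by rewrite -(centered_covariance cB)// covB.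
Qed.

Lemma fbm_mean_sqr t : 0 < H -> 0 <= t -> mean P (fun w => B t w ^+ 2) = t `^ (2 * H).
Proof.
by move=> H0 t0; rewrite -fbm_cov_diag// -fbm_meanM//.
Qed.

Lemma fbm_pint t s : 0 <= t -> 0 <= s -> pint P (fun w => B t w * B s w).
Proof.
move=> t0 s0; have [gB cB _] := fB.
by have [] := gaussian_like_pair (gaussian_family_pair gB cB t0 s0).
Qed.

(** The variance of [B 2 - 2 * B 1] is [4 - (2 `^ H) ^+ 2]. *)
Lemma fbm_hurst_le1 : 0 < H -> H <= 1.
Proof.
move=> H0.
have : 0 <= mean P (fun w => (B 2 w + - 2 * B 1 w) ^+ 2).
  by apply: Rintegral_ge0 => w _; exact: sqr_ge0.
have -> : (fun w => (B 2 w + - 2 * B 1 w) ^+ 2) =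
  (fun w => (B 2 w ^+ 2 + 4 * B 1 w ^+ 2) + - 4 * (B 2 w * B 1 w)).
  by apply/funext => w; ring.
have q2 := fbm_pint (ler0n R 2) (ler0n R 2).
have q1 := fbm_pint (ler01 : 0 <= (1 : R)) (ler01 : 0 <= (1 : R)).
have p21 := fbm_pint (ler0n R 2) (ler01 : 0 <= (1 : R)).
have q1' := pintZ 4 q1.
rewrite (meanD (pintD q2 q1') (pintZ _ p21)) (meanD q2 q1') !meanZ//.
rewrite !fbm_mean_sqr// fbm_meanM// /fbm_cov !powR1.
rewrite (_ : 2 - 1 = 1 :> R) ?normr1 ?powR1; last by ring.
have -> : 2 `^ (2 * H) = (2 `^ H) ^+ 2 :> R.
  by rewrite mulrC powRrM powR_mulrn ?powR_ge0.
move=> pos; rewrite leNgt; apply/negP => H1.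
have h2 : 2 < 2 `^ H :> R.
  rewrite lt_neqAle le1r_powR ?ltW ?ltr1n// andbT; apply/eqP => /(congr1 (@ln R)).
  have ln2 : 0 < ln 2 :> R by rewrite ln_gt0// ltr1n.
  rewrite ln_powR -[LHS]mul1r => /mulIf H1E.
  by move: H1; rewrite -H1E ?ltxx// gt_eqF.
nra.
Qed.

End fbm_process.

Section fbm_sampling.
Context {R : realType} {disp : measure_display} {Omega : measurableType disp}.
Variable P : probability Omega R.

(** The times [T * theta ^+ k] with small [theta] serve all fractional Brownian
    motions of index [H] at once, hence all the projections of a vector-valued
    one. *)
Lemma fbm_sample_times (H : R) (N : nat) (T : R) :
  0 < H -> H < 1 -> (0 < N)%N -> 0 < T ->
  exists t : 'I_N -> R, (forall k, 0 < t k <= T) /\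
    forall B : R -> Omega -> R, standard_fbm P H B ->
    let b := fun k w => (t k `^ H)^-1 * B (t k) w in
    [/\ forall a : 'I_N -> R, gaussian_like P (fun w => \sum_j a j * b j w),
        forall j, mean P (fun w => b j w ^+ 2) = 1 &
        forall j k, j != k -> `|mean P (fun w => b j w * b k w)| <= N%:R^-1].
Proof.
move=> H0 H1 N0 T0.
have e0 : 0 < (N%:R : R)^-1 by rewrite invr_gt0 ltr0n.
have [th [th0 th1 small]] := fbm_cov_small H0 H1 e0.
pose t (k : 'I_N) := T * th ^+ k; exists t.
have t0 k : 0 < t k by rewrite mulr_gt0// exprn_gt0.
split.
  by move=> k; rewrite t0 ler_piMr ?exprn_ile1// ltW.
move=> B fB b.
have tn k : 0 <= t k by exact/ltW.
have tH k : 0 < t k `^ H by exact: powR_gt0.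
have bb j k : mean P (fun w => b j w * b k w) =
    (t j `^ H * t k `^ H)^-1 * fbm_cov H (t j) (t k).
  rewrite -(fbm_meanM fB)// -meanZ.
    by congr (mean P); apply/funext => w; rewrite /b invfM; ring.
  exact: fbm_pint fB _ _ _ _.
split.
- move=> a; have [gB cB _] := fB.
  have := gaussian_family_lincomb gB cB (fun j => a j * (t j `^ H)^-1) tn.
  by under eq_fun do under eq_bigr do rewrite -mulrA.
- move=> j; under [fun w => _]eq_fun do rewrite expr2.
  rewrite bb fbm_cov_diag// (_ : 2 * H = H + H); last by ring.
  rewrite powRD; last by rewrite (gt_eqF (t0 j)) implybT.
  by rewrite mulVf// mulf_neq0// gt_eqF.
- move=> j k; wlog jk : j k / (j < k)%N.
    move=> W jk; have := jk; rewrite -val_eqE neq_ltn => /orP[lt|lt]; first exact: W.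
    by under eq_fun do rewrite mulrC; apply: W => //; rewrite eq_sym.
  move=> _; rewrite bb normrM gtr0_norm ?invr_gt0 ?mulr_gt0//.
  rewrite mulrC ler_pdivrMr ?mulr_gt0//; apply: small => //.
  rewrite /t mulrCA ler_pM2l// -exprS.
  by rewrite ler_wiXn2l// ltW.
Qed.

End fbm_sampling.

(** * Samples that meet every half-space *)

Section empirical_measure.
Context {R : realType} {n : nat}.
Implicit Types (e : 'rV[R]_n).

Lemma term_le_sum2 (f : 'I_n -> 'I_n -> R) : (forall i j, 0 <= f i j) ->
  forall i j, f i j <= \sum_i \sum_j f i j.
Proof.
move=> f0 i j; rewrite (bigD1 i)//= (bigD1 j)//= -addrA lerDl addr_ge0//.
  exact: sumr_ge0.
by do 2![apply: sumr_ge0 => ? _].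
Qed.

Definition norm1 e : R := \sum_i `|e 0 i|.

(** If all [dotv (z k) e] were below [eta * norm1 e], they would be negative up to
    a small error; as their mean is small, so would be the mean of their absolute
    values. With the threshold [c = a * norm1 e], the inequality
    x^2 <= c |x| + x^4 / c^2 bounds the mean of the squares, which is at least
    [(lam - eta) * norm1 e ^+ 2]. The data are given through the sums
    [z k 0 i + z k 0 j], that is, through scalar projections only. *)
Lemma empirical_direction N (z : 'I_N -> 'rV[R]_n) (Q : 'M[R]_n)
    (lam eta a K : R) e :
  (0 < N)%N -> 0 <= eta -> 0 < a -> eta * (1 + 3 * a) + K / a ^+ 2 < lam ->
  (forall i j, `|\sum_k (z k 0 i + z k 0 j)| <= eta * N%:R) ->
  (forall i j, `|\sum_k (z k 0 i + z k 0 j) ^+ 2 -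
                 N%:R * (Q i i + Q j j + 2 * Q i j)| <= eta * N%:R) ->
  \sum_k \sum_i \sum_j (z k 0 i + z k 0 j) ^+ 4 <= K * N%:R ->
  lam * norm1 e ^+ 2 <= \sum_i \sum_j e 0 i * e 0 j * Q i j ->
  exists k, eta * norm1 e <= dotv (z k) e.
Proof.
move=> N0 eta0 a0 small hm hv h4 hQ; set L := norm1 e.
have Nr0 : 0 < N%:R :> R by rewrite ltr0n.
have L0 : 0 <= L by exact: sumr_ge0.
pose D k := dotv (z k) e.
have [L00|Lneq0] := eqVneq L 0.
  exists (Ordinal N0); rewrite L00 mulr0 /dotv sumr_ge0// => i _.
  have /allP/(_ i (mem_index_enum i))/= := etrans (esym (@psumr_eq0 _ _ _ predT _ (fun i _ => normr_ge0 (e 0 i)))) (introT eqP L00).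
  by rewrite normr_eq0 => /eqP->; rewrite mulr0.
have Lgt0 : 0 < L by rewrite lt_neqAle eq_sym Lneq0.
apply: contrapT => nex.
have small_dot k : D k < eta * L.
  by rewrite ltNge; apply/negP => h; apply: nex; exists k.
pose y i j k := z k 0 i + z k 0 j.
have F1 : `|\sum_k D k| <= eta * N%:R * L.
  have -> : \sum_k D k = \sum_i 2^-1 * e 0 i * \sum_k y i i k.
    rewrite exchange_big; apply: eq_bigr => i _; rewrite mulr_sumr.
    by apply: eq_bigr => k _; rewrite /y; field.
  apply: le_trans (ler_norm_sum _ _ _) _; rewrite mulr_sumr; apply: ler_sum => i _.
  rewrite !normrM mulrC ler_pM ?mulr_ge0//; first exact: hm.
  by rewrite ger0_norm// ler_piMl// invf_le1// ler1n.
pose Del i j := \sum_k y i j k ^+ 2 - N%:R * (Q i i + Q j j + 2 * Q i j).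
have F2 : N%:R * ((lam - eta) * L ^+ 2) <= \sum_k D k ^+ 2.
  have -> : \sum_k D k ^+ 2 = N%:R * (\sum_i \sum_j e 0 i * e 0 j * Q i j) +
      \sum_i \sum_j e 0 i * e 0 j * (2^-1 * (Del i j - 4^-1 * Del i i - 4^-1 * Del j j)).
    (* Polarisation: z_i z_j is a combination of squares of the y i j. *)
    rewrite mulr_sumr -big_split/=.
    under eq_bigr do rewrite /D /dotv expr2 big_distrlr.
    rewrite exchange_big/=; apply: eq_bigr => i _.
    rewrite exchange_big/= mulr_sumr -big_split/=; apply: eq_bigr => j _.
    have -> : \sum_k z k 0 i * e 0 i * (z k 0 j * e 0 j) =
      e 0 i * e 0 j * (2^-1 * (\sum_k y i j k ^+ 2 - 4^-1 * \sum_k y i i k ^+ 2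
         - 4^-1 * \sum_k y j j k ^+ 2)).
      rewrite !mulr_sumr -!sumrB !mulr_sumr; apply: eq_bigr => k _; rewrite /y; by field.
    by rewrite /Del; field.
  rewrite [leLHS](_ : _ = N%:R * (lam * L ^+ 2) - eta * N%:R * L ^+ 2); last by ring.
  apply: lerD; first by rewrite ler_pM2l.
  rewrite lerNl.
  apply: le_trans (ler_norm _) _; rewrite normrN.
  apply: le_trans (ler_norm_sum _ _ _) _.
  rewrite expr2 {1 2}/L /norm1 big_distrlr mulr_sumr; apply: ler_sum => i _.
  apply: le_trans (ler_norm_sum _ _ _) _; rewrite mulr_sumr; apply: ler_sum => j _.
  rewrite !normrM mulrC ler_wpM2r ?mulr_ge0//.
  have := hv i j; have := hv i i; have := hv j j.
  rewrite -/(Del i j) -/(Del i i) -/(Del j j) => hjj hii hij.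
  have eN0 : 0 <= eta * N%:R by rewrite mulr_ge0// ltW.
  move: hjj hii hij; rewrite !ler_norml ger0_norm// => /andP[? ?] /andP[? ?] /andP[? ?].
  rewrite mulrC ler_pdivrMr// ler_norml; lra.
pose S k := \sum_i \sum_j y i j k ^+ 4.
have S0 k : 0 <= S k.
  by do 2![apply: sumr_ge0 => ? _]; rewrite exprn_even_ge0.
have F3 k : D k ^+ 4 <= L ^+ 4 * S k.
  (* The fourth root of S k bounds all the coordinates of z k. *)
  pose r := Num.sqrt (Num.sqrt (S k)).
  have r0 : 0 <= r by exact: sqrtr_ge0.
  have r4 : r ^+ 4 = S k.
    by rewrite (exprM _ 2 2) !sqr_sqrtr// sqrtr_ge0.
  have zr i : `|z k 0 i| <= r.
    rewrite -(@ler_pXn2r _ 4)// ?nnegrE// r4 -normrX ger0_norm ?exprn_even_ge0//.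
    apply: (@le_trans _ _ (y i i k ^+ 4)); last first.
      by apply: (@term_le_sum2 (fun i j => y i j k ^+ 4)) => i' j'; rewrite exprn_even_ge0.
    rewrite (_ : y i i k ^+ 4 = 16 * z k 0 i ^+ 4); last by rewrite /y; ring.
    by rewrite ler_peMl ?exprn_even_ge0// ler1n.
  rewrite -r4 -exprMn (_ : D k ^+ 4 = `|D k| ^+ 4); last first.
    by rewrite -normrX ger0_norm// exprn_even_ge0.
  rewrite ler_pXn2r ?nnegrE ?mulr_ge0//.
  apply: le_trans (ler_norm_sum _ _ _) _; rewrite mulr_suml; apply: ler_sum => i _.
  by rewrite normrM mulrC ler_wpM2l.
have aL : 0 < a * L by rewrite mulr_gt0.
have F4 k : D k ^+ 2 <= a * L * (2 * (eta * L) - D k) + L ^+ 2 / a ^+ 2 * S k.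
  apply: (@le_trans _ _ (a * L * `|D k| + D k ^+ 4 / (a * L) ^+ 2)).
    have [h|h] := leP `|D k| (a * L).
      apply: ler_wpDr; first by rewrite divr_ge0 ?sqr_ge0// exprn_even_ge0.
      by rewrite -real_normK ?num_real// expr2 ler_wpM2r.
    apply: ler_wpDl; first by rewrite mulr_ge0// ltW.
    rewrite ler_pdivlMr ?exprn_gt0// (exprD _ 2 2).
    rewrite ler_wpM2l ?sqr_ge0// -(real_normK (num_real (D k))).
    by rewrite ler_pXn2r ?nnegrE// ltW.
  apply: lerD.
    rewrite ler_wpM2l ?(ltW aL)// ler_norml; have := small_dot k.
    have : 0 <= eta * L by rewrite mulr_ge0.
    by move=> ? ?; apply/andP; split; lra.
  rewrite ler_pdivrMr ?exprn_gt0//; apply: le_trans (F3 k) _.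
  by rewrite [leRHS](_ : _ = L ^+ 4 * S k)//; field; exact: lt0r_neq0.
have : \sum_k D k ^+ 2 <= \sum_k (a * L * (2 * (eta * L) - D k) + L ^+ 2 / a ^+ 2 * S k).
  by apply: ler_sum => k _; exact: F4.
rewrite big_split/= -!mulr_sumr sumrB sumr_const card_ord -[X in X - _]mulr_natr.
have F1' : - \sum_k D k <= eta * N%:R * L.
  by move: F1; rewrite ler_norml => /andP[? _]; rewrite lerNl.
move=> up.
have : N%:R * ((lam - eta) * L ^+ 2) <=
  a * L * (2 * (eta * L) * N%:R + eta * N%:R * L) + L ^+ 2 / a ^+ 2 * (K * N%:R).
  apply: le_trans F2 _; apply: le_trans up _; apply: lerD.
    by rewrite ler_wpM2l ?(ltW aL)// lerD2l.
  by rewrite ler_wpM2l// divr_ge0 ?sqr_ge0.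
rewrite [leRHS](_ : _ = N%:R * ((3 * a * eta + K / a ^+ 2) * L ^+ 2)); last by field; exact: lt0r_neq0.
rewrite ler_pM2l// ler_pM2r ?exprn_gt0//; move: small; rewrite mulrDr mulr1.
set c := K / _; move=> s1 s2; have : eta * (3 * a) = 3 * a * eta by ring.
move=> E; rewrite E in s1; lra.
Qed.

End empirical_measure.

(** * Separation of a point from a closed convex set *)

Section separation.
Context {R : realType} {n : nat}.
Implicit Types (e x p c : 'rV[R]_n) (C : set 'rV[R]_n).

Definition sqdist x p : R := \sum_i (x 0 i - p 0 i) ^+ 2.

Lemma continuous_sqdist p : continuous (sqdist ^~ p).
Proof.
rewrite /sqdist; elim: (index_enum _) => [|i s IH].
  by under eq_fun do rewrite big_nil; exact: cst_continuous.
under eq_fun do rewrite big_cons.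
have cB : continuous (fun x : 'rV[R]_n => x 0 i - p 0 i).
  by move=> x; apply: continuousB; [exact: coord_continuous | exact: cst_continuous].
have c2 : continuous (fun x : 'rV[R]_n => (x 0 i - p 0 i) ^+ 2).
  move=> x; apply: (@continuous_comp _ _ _ (fun x : 'rV[R]_n => x 0 i - p 0 i)
    (fun y : R => y ^+ 2)); first exact: cB.
  exact: exprn_continuous.
by move=> x; exact: (continuousD (c2 x) (IH x)).
Qed.

Lemma closed_nearest_point C p : closed C -> C !=set0 ->
  exists2 c, C c & forall x, C x -> sqdist c p <= sqdist x p.
Proof.
move=> clC [x0 Cx0].
pose C' := C `&` [set x | sqdist x p <= sqdist x0 p].
pose M := 1 + sqdist x0 p.
have cC' : compact C'.
  have cbox : compact [set v : 'rV[R]_n | forall i, v ord0 i \in `[p 0 i - M, p 0 i + M]].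
    apply: (@rV_compact _ _ (fun i => `[p 0 i - M, p 0 i + M]%classic)) => i.
    exact: segment_compact.
  apply: (subclosed_compact _ cbox).
    apply: closedI => //; apply: (preimage_closed _ (@closed_le _ _)) => x _.
    exact: continuous_sqdist.
  move=> x [_ /= xle] i; rewrite in_itv/= -ler_distl.
  have h : (x ord0 i - p 0 i) ^+ 2 <= sqdist x0 p.
    apply: le_trans xle; rewrite /sqdist (bigD1 i)//= lerDl.
    by apply: sumr_ge0 => j _; exact: sqr_ge0.
  have [h1|/ltW h1] := leP `|x ord0 i - p 0 i| 1.
    by rewrite (le_trans h1)// /M lerDl (le_trans _ h)// sqr_ge0.
  apply: (@le_trans _ _ (`|x ord0 i - p 0 i| ^+ 2)); first by rewrite expr2 ler_peMl.
  by rewrite real_normK ?num_real// (le_trans h)// /M lerDr.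
have [||c Cc cmin] := @compact_EVT_min _ R (sqdist ^~ p) C' _ cC'.
- by exists x0; split => //=.
- by apply: continuous_subspaceT => x; exact: continuous_sqdist.
move: Cc; rewrite inE => -[Cc cx0].
exists c => // x Cx; have [h|/ltW h] := leP (sqdist x p) (sqdist x0 p).
  by apply: cmin; rewrite inE.
exact: le_trans h.
Qed.

(** Moving from [c] towards [x] by a small proportion [l] would otherwise decrease
    the distance to [p] to first order in [l]. *)
Lemma nearest_point_separates C p c : @convex_set R 'rV[R]_n C -> C c ->
  (forall x, C x -> sqdist c p <= sqdist x p) ->
  forall x, C x -> dotv x (p - c) <= dotv c (p - c).
Proof.
move=> cC Cc cmin x Cx.
pose s := dotv x (p - c) - dotv c (p - c).
pose M := sqdist x c.
have M0 : 0 <= M by apply: sumr_ge0 => i _; exact: sqr_ge0.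
rewrite leNgt -subr_gt0 -/s; apply/negP => s0.
have sM : 0 < s + M by rewrite ltr_wpDr.
have [l [l0 l1 ls]] : exists l : R, [/\ 0 < l, l <= 1 & l * M < 2 * s].
  exists (s / (s + M)); rewrite divr_gt0// ler_pdivrMr// mul1r lerDl; split => //.
  rewrite mulrAC ltr_pdivrMr//; nra.
have /set_mem := @cC x c (Itv01 (ltW l0) l1) (mem_set Cx) (mem_set Cc).
move=> /cmin; rewrite leNgt => /negP; apply.
rewrite -subr_gt0.
rewrite [X in 0 < X](_ : _ = l * (2 * s - l * M)); last first.
  rewrite /M /s /dotv -sumrB /sqdist -sumrB [l * \sum_i _]mulr_sumr.
  rewrite mulr_sumr -sumrB mulr_sumr; apply: eq_bigr => i _.
  by rewrite /conv/= !mxE /unstable.onem; ring.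
by rewrite mulr_gt0// subr_gt0.
Qed.

(** If [p] with norm less than [kappa] had nearest point [c <> p] in [C], the
    direction [e = p - c] would satisfy [dotv x e <= dotv c e < dotv p e <=
    kappa * norm1 e] for all [x] in [C]; the norm of row vectors is the sup norm,
    dual to [norm1]. *)
Lemma ball_of_directions C (kappa : R) : closed C -> @convex_set R 'rV[R]_n C ->
  0 < kappa -> (forall e, exists2 x, C x & kappa * norm1 e <= dotv x e) ->
  C^° 0.
Proof.
move=> clC cC k0 dirs.
have C0 : C !=set0 by have [x Cx _] := dirs 0; exists x.
rewrite /interior; apply/nbhs_ballP; exists kappa => //= p.
rewrite -ball_normE/= sub0r normrN => pk.
have pik i : `|p 0 i| < kappa.
  apply: le_lt_trans pk.
  have /mapP[j Hj ->] : `|p 0 i| \in [seq `|p x.1 x.2| | x : 'I_1 * 'I_n].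
    by apply/mapP; exists (0, i) => //=; rewrite mem_enum.
  by rewrite [leRHS]/Num.Def.normr /= mx_normrE; apply/bigmax_geP; right => /=; exists j.
apply: contrapT => nCp.
have [c Cc cmin] := closed_nearest_point p clC C0.
have sep := nearest_point_separates cC Cc cmin.
have [x Cx xe] := dirs (p - c).
have pe : dotv p (p - c) <= kappa * norm1 (p - c).
  rewrite /dotv /norm1 mulr_sumr; apply: ler_sum => i _.
  apply: le_trans (ler_norm _) _; rewrite normrM ler_wpM2r//.
  exact: ltW.
have pc : 0 < dotv p (p - c) - dotv c (p - c).
  have -> : dotv p (p - c) - dotv c (p - c) = sqdist p c.
    by rewrite /dotv /sqdist -sumrB; apply: eq_bigr => i _; rewrite !mxE; ring.
  rewrite lt_neqAle eq_sym sumr_ge0 ?andbT; last by move=> i _; exact: sqr_ge0.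
  apply/eqP => /eqP; rewrite psumr_eq0; last by move=> i _; exact: sqr_ge0.
  move=> /allP e0; apply: nCp; rewrite (_ : p = c)//.
  apply/rowP => i; have /= := e0 i (mem_index_enum i).
  by rewrite sqrf_eq0 subr_eq0 => /eqP.
have := sep x Cx; lra.
Qed.

End separation.

(** * Nondegenerate quadratic forms *)

Section quadratic_form.
Context {R : realType} {n : nat}.
Implicit Types (e f : 'rV[R]_n) (Q : 'M[R]_n).

Definition bform Q e f : R := \sum_i \sum_j e 0 i * f 0 j * Q i j.

Lemma bformE Q e f : bform Q e f = (e *m Q *m f^T) 0 0.
Proof.
rewrite /bform mxE exchange_big/=; apply: eq_bigr => j _.
rewrite !mxE mulr_suml; apply: eq_bigr => i _; ring.
Qed.

Lemma bformBZ Q e f x : Q^T = Q ->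
  bform Q (f - x *: e) (f - x *: e) = bform Q f f - 2 * x * bform Q f e + x ^+ 2 * bform Q e e.
Proof.
move=> Qs; have sym : bform Q e f = bform Q f e.
  rewrite /bform exchange_big; apply: eq_bigr => i _; apply: eq_bigr => j _.
  by rewrite -[in LHS]Qs mxE [e 0 _ * _]mulrC.
have -> : 2 * x * bform Q f e = x * bform Q f e + x * bform Q e f by rewrite sym; ring.
rewrite opprD addrA /bform !mulr_sumr -!sumrB -!big_split/=; apply: eq_bigr => i _.
rewrite !mulr_sumr -!sumrB -!big_split/=; apply: eq_bigr => j _.
rewrite !mxE; ring.
Qed.

(** The rows of the inverse of [Q] represent the coordinates through the form:
    [bform Q (f i) e = e 0 i]. By Cauchy-Schwarz, [e 0 i ^+ 2] is at most
    [bform Q (f i) (f i) * bform Q e e]. *)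
Lemma nondegenerate_form_coercive Q : (0 < n)%N -> Q^T = Q -> \rank Q = n ->
  (forall e, 0 <= bform Q e e) ->
  exists2 lam : R, 0 < lam & forall e, lam * norm1 e ^+ 2 <= bform Q e e.
Proof.
move=> n0 Qs Qr Qge0.
have Qu : Q \in unitmx by rewrite -row_full_unit /row_full Qr.
pose f i := row i (invmx Q).
have fe i e : bform Q (f i) e = e 0 i.
  rewrite bformE -row_mul mulVmx// -row_mul mul1mx !mxE//.
pose g := 1 + \sum_i bform Q (f i) (f i).
have fg i : bform Q (f i) (f i) <= g.
  rewrite /g (bigD1 i)//= addrCA lerDl addr_ge0//.
  by apply: sumr_ge0 => j _; exact: Qge0.
have g0 : 0 < g by rewrite ltr_wpDr//; apply: sumr_ge0 => j _; exact: Qge0.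
have n0' : 0 < n%:R :> R by rewrite ltr0n.
exists (n%:R ^+ 2 * g)^-1; first by rewrite invr_gt0 mulr_gt0// exprn_gt0.
move=> e; rewrite mulrC ler_pdivrMr ?mulr_gt0 ?exprn_gt0//.
set q := bform Q e e.
have q0 : 0 <= q by exact: Qge0.
have ei i : e 0 i ^+ 2 <= g * q.
  have [->|u0] := eqVneq (e 0 i) 0; first by rewrite expr0n mulr_ge0// ltW.
  have u20 : 0 < e 0 i ^+ 2 by rewrite exprn_even_gt0.
  (* Discriminant argument; this multiplier also covers the case q = 0. *)
  have := Qge0 (f i - (g / e 0 i) *: e); rewrite bformBZ// (fe i e) -/q.
  rewrite [X in 0 <= X](_ : _ = bform Q (f i) (f i) - 2 * g + g * (g * q / e 0 i ^+ 2)); last by field.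
  move=> h; have {h} : g * 1 <= g * (g * q / e 0 i ^+ 2) by have := fg i; lra.
  by rewrite ler_pM2l// ler_pdivlMr// mul1r.
pose r := Num.sqrt (g * q).
have r0 : 0 <= r by exact: sqrtr_ge0.
have r2 : r ^+ 2 = g * q by rewrite sqr_sqrtr// mulr_ge0// ltW.
have er i : `|e 0 i| <= r.
  by rewrite -(@ler_pXn2r _ 2)// ?nnegrE// r2 real_normK ?num_real.
have : norm1 e <= n%:R * r.
  rewrite mulr_natl -[X in _ *+ X]card_ord -sumr_const.
  by apply: ler_sum => i _.
rewrite -(@ler_pXn2r _ 2)// ?nnegrE ?mulr_ge0//; last by apply: sumr_ge0.
by rewrite exprMn r2 mulrA mulrC.
Qed.

End quadratic_form.

(** * The directions reached by the path *)

Section markov.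
Context {R : realType} {disp : measure_display} {Omega : measurableType disp}.
Variable P : probability Omega R.

Lemma markov_mean (f : Omega -> R) (c : R) : 0 < c -> pint P f ->
  (forall w, 0 <= f w) ->
  measurable [set w | c <= f w] /\ (P [set w | (c <= f w)%R] <= (mean P f / c)%:E)%E.
Proof.
move=> c0 pf f0; have mf := pint_measurable pf.
have mA : measurable [set w | c <= f w].
  rewrite (_ : [set _ | _] = f @^-1` `[c, +oo[); last first.
    by apply/seteqP; split => w /=; rewrite in_itv/= andbT.
  by rewrite -[X in measurable X]setTI; exact: mf.
split=> //; rewrite mulrC EFinM lee_pdivlMl//.
rewrite -integral_cst// -(mean_EFin pf).
apply: (@le_trans _ _ (\int[P]_(w in [set w | (c <= f w)%R]) (f w)%:E)%E).
  apply: ge0_le_integral => //.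
  - by move=> w _; rewrite lee_fin ltW.
  - by apply/measurable_EFinP; apply: measurable_funS mf.
apply: ge0_subset_integral => //.
  exact/measurable_EFinP.
by move=> w _; rewrite lee_fin.
Qed.

End markov.

Section fbm_directions.
Context {R : realType} {disp : measure_display} {Omega : measurableType disp}.
Variable P : probability Omega R.
Context {n : nat} (H : R) (X : R -> Omega -> 'rV[R]_n).
Hypothesis n0 : (0 < n)%N.
Hypothesis H0 : 0 < H.
Hypothesis H1 : H < 1.
Hypothesis fX : fractional_brownian_motion P H X.

Local Notation Q := (covariance_mx P (X 1)).

Let meanX1 i j : Q i j = mean P (fun w => X 1 w 0 i * X 1 w 0 j).
Proof.
have [[_ cX] _ _] := fX; rewrite mxE.
exact: (@centered_covariance _ _ _ P _ _ _ cX (1, i) (1, j) (ler01 : 0 <= (1 : R))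
  (ler01 : 0 <= (1 : R))).
Qed.

Let pintX1 i j : pint P (fun w => X 1 w 0 i * X 1 w 0 j).
Proof.
have [[gX cX] _ _] := fX.
have [//] := gaussian_like_pair (@gaussian_family_pair _ _ _ P _ _ _ gX cX (1, i) (1, j)
  (ler01 : 0 <= (1 : R)) (ler01 : 0 <= (1 : R))).
Qed.

Lemma covariance_mx_sym : Q^T = Q.
Proof. by apply/matrixP => i j; rewrite !mxE covarianceC. Qed.

Lemma fbm_scale e (c : R) (B : R -> Omega -> R) : standard_fbm P H B ->
  (forall t w, 0 <= t -> dotv (X t w) e = c * B t w) -> bform Q e e = c ^+ 2.
Proof.
move=> fB cB.
have -> : c ^+ 2 = mean P (fun w => dotv (X 1 w) e ^+ 2).
  have -> : (fun w => dotv (X 1 w) e ^+ 2) = (fun w => c ^+ 2 * B 1 w ^+ 2).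
    by apply/funext => w; rewrite cB// exprMn.
  rewrite meanZ; last exact: (fbm_pint fB ler01 ler01).
  by rewrite (fbm_mean_sqr fB)// powR1 mulr1.
have -> : (fun w => dotv (X 1 w) e ^+ 2) = (fun w => \sum_i \sum_j
    e 0 i * e 0 j * (X 1 w 0 i * X 1 w 0 j)).
  apply/funext => w; rewrite /dotv expr2 big_distrlr; apply: eq_bigr => i _.
  by apply: eq_bigr => j _ /=; ring.
rewrite mean_sum; last by move=> i _; apply: pint_sum => j _; exact: pintZ.
apply: eq_bigr => i _; rewrite mean_sum; last by move=> j _; exact: pintZ.
by apply: eq_bigr => j _; rewrite meanZ// meanX1.
Qed.

(** Linear growth in [N] is what makes the Markov inequality effective: the square
    deviations are compared below with [(eta * N%:R) ^+ 2]. The constants depend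
    only on the scales of the projections of [X] on the sums of two coordinate
    vectors. *)
Lemma fbm_sample_estimates : exists C1 C2 : R, [/\ 0 <= C1, 0 <= C2 &
  forall (N : nat) (T : R), (0 < N)%N -> 0 < T ->
  exists t : 'I_N -> R, (forall k, 0 < t k <= T) /\
    let y i j w k := (t k `^ H)^-1 * (X (t k) w 0 i + X (t k) w 0 j) in
    let dev w := \sum_i \sum_j ((\sum_k y i j w k) ^+ 2 +
      (\sum_k y i j w k ^+ 2 - N%:R * (Q i i + Q j j + 2 * Q i j)) ^+ 2) in
    let kurt w := \sum_k \sum_i \sum_j y i j w k ^+ 4 in
    [/\ pint P dev, mean P dev <= C1 * N%:R, pint P kurt & mean P kurt <= C2 * N%:R]].
Proof.
have [_ _ prj] := fX.
pose d i j : 'rV[R]_n := delta_mx 0 i + delta_mx 0 j.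
have dotd i j (x : 'rV[R]_n) : dotv x (d i j) = x 0 i + x 0 j.
  have dl (l : 'I_n) : \sum_k x 0 k * (delta_mx 0 l : 'rV[R]_n) 0 k = x 0 l.
    rewrite (bigD1 l)//= mxE !eqxx mulr1 big1 ?addr0// => k /negbTE kl.
    by rewrite mxE kl andbF mulr0.
  by rewrite /dotv -(dl i) -(dl j) -big_split/=; apply: eq_bigr => k _; rewrite [d i j _ _]mxE mulrDr.
have /choice[cB cBP] : forall p : 'I_n * 'I_n, exists cB : R * (R -> Omega -> R),
    standard_fbm P H cB.2 /\
    forall t w, 0 <= t -> dotv (X t w) (d p.1 p.2) = cB.1 * cB.2 t w.
  by move=> p; have [c [B h]] := prj (d p.1 p.2); exists (c, B).
pose c i j := (cB (i, j)).1; pose B i j := (cB (i, j)).2.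
have fB i j : standard_fbm P H (B i j) by have [] := cBP (i, j).
have XB i j t w : 0 <= t -> X t w 0 i + X t w 0 j = c i j * B i j t w.
  by move=> t0; rewrite -dotd; have [_] := cBP (i, j); apply.
have Qc i j : Q i i + Q j j + 2 * Q i j = c i j ^+ 2.
  have [h1 h2] := cBP (i, j); rewrite -(fbm_scale h1 h2) /=.
  have -> : bform Q (d i j) (d i j) = dotv (\row_k (Q k i + Q k j)) (d i j).
    rewrite /bform /dotv; apply: eq_bigr => k _.
    rewrite [in RHS]mxE [RHS]mulrC.
    have -> : Q k i + Q k j = dotv (row k Q) (d i j) by rewrite dotd [row k Q _ _]mxE [row k Q _ j]mxE.
    rewrite /dotv mulr_sumr; apply: eq_bigr => l _.
    by rewrite [row k Q _ _]mxE; ring.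
  rewrite dotd ![(\row_k _) _ _]mxE.
  have -> : Q j i = Q i j by rewrite -[in LHS]covariance_mx_sym mxE.
  by ring.
exists (\sum_i \sum_j (2 * c i j ^+ 2 + 4 * c i j ^+ 4)), (\sum_i \sum_j (3 * c i j ^+ 4)).
split.
- do 2![apply: sumr_ge0 => ? _]; rewrite addr_ge0// mulr_ge0// ?sqr_ge0//.
  by rewrite exprn_even_ge0.
- by do 2![apply: sumr_ge0 => ? _]; rewrite mulr_ge0// exprn_even_ge0.
move=> N T N0 T0; have [t [tT samp]] := fbm_sample_times P H0 H1 N0 T0.
exists t; split=> //= .
have t0 k : 0 <= t k by have /andP[/ltW] := tT k.
pose b i j k w := (t k `^ H)^-1 * B i j (t k) w.
have sb i j := samp _ (fB i j).
have yb i j w k : (t k `^ H)^-1 * (X (t k) w 0 i + X (t k) w 0 j) = c i j * b i j k w.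
  by rewrite XB// /b; ring.
pose g i j w := c i j ^+ 2 * (\sum_k b i j k w) ^+ 2 +
  c i j ^+ 4 * (\sum_k (b i j k w ^+ 2 - 1)) ^+ 2.
have gE : (fun w => \sum_i \sum_j
    ((\sum_k (t k `^ H)^-1 * (X (t k) w 0 i + X (t k) w 0 j)) ^+ 2 +
     (\sum_k ((t k `^ H)^-1 * (X (t k) w 0 i + X (t k) w 0 j)) ^+ 2 -
       N%:R * (Q i i + Q j j + 2 * Q i j)) ^+ 2)) = (fun w => \sum_i \sum_j g i j w).
  apply/funext => w; apply: eq_bigr => i _; apply: eq_bigr => j _.
  under eq_bigr do rewrite yb; under [X in _ + (X - _) ^+ 2]eq_bigr do rewrite yb exprMn.
  rewrite Qc -!mulr_sumr /g sumrB sumr_const card_ord.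
  by rewrite -[1 *+ N]/(N%:R : R); ring.
have kE : (fun w => \sum_k \sum_i \sum_j
    ((t k `^ H)^-1 * (X (t k) w 0 i + X (t k) w 0 j)) ^+ 4) =
    (fun w => \sum_i \sum_j \sum_k c i j ^+ 4 * b i j k w ^+ 4).
  apply/funext => w; rewrite exchange_big; apply: eq_bigr => i _.
  rewrite exchange_big; apply: eq_bigr => j _; apply: eq_bigr => k _.
  by rewrite yb exprMn.
rewrite gE kE.
have pk i j k : pint P (fun w => c i j ^+ 4 * b i j k w ^+ 4) /\
    mean P (fun w => c i j ^+ 4 * b i j k w ^+ 4) = 3 * c i j ^+ 4.
  have [gb b1 bN] := sb i j; have [p4 m4] := mean_expr4 gb b1 k.
  by rewrite meanZ// m4 mulrC; split => //; exact: pintZ.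
have pg i j : pint P (g i j) /\
    mean P (g i j) <= (2 * c i j ^+ 2 + 4 * c i j ^+ 4) * N%:R.
  have [gb b1 bN] := sb i j.
  have [p2 m2] := mean_sqr_sum_le N0 gb b1 bN.
  have [q2 l2] := mean_sqr_dev_le N0 gb b1 bN.
  have p2' := pintZ (c i j ^+ 2) p2; have q2' := pintZ (c i j ^+ 4) q2.
  split; first exact: pintD p2' q2'.
  rewrite (meanD p2' q2') !meanZ// mulrDl lerD//.
    by rewrite -mulrA mulrCA ler_wpM2l// sqr_ge0.
  by rewrite -mulrA mulrCA ler_wpM2l// exprn_even_ge0.
split.
- by apply: pint_sum => i _; apply: pint_sum => j _; case: (pg i j).
- rewrite mean_sum; last by move=> i _; apply: pint_sum => j _; case: (pg i j).
  rewrite mulr_suml; apply: ler_sum => i _.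
  rewrite mean_sum; last by move=> j _; case: (pg i j).
  by rewrite mulr_suml; apply: ler_sum => j _; case: (pg i j).
- apply: pint_sum => i _; apply: pint_sum => j _; apply: pint_sum => k _.
  by case: (pk i j k).
- rewrite mean_sum; last first.
    move=> i _; apply: pint_sum => j _; apply: pint_sum => k _; by case: (pk i j k).
  rewrite mulr_suml; apply: ler_sum => i _.
  rewrite mean_sum; last first.
    move=> j _; apply: pint_sum => k _; by case: (pk i j k).
  rewrite mulr_suml; apply: ler_sum => j _.
  rewrite mean_sum; last by move=> k _; case: (pk i j k).
  under eq_bigr do rewrite (pk _ _ _).2.
  by rewrite sumr_const card_ord mulr_natr.
Qed.

Hypothesis rQ : \rank Q = n.

(** The exceptional event is the union of two events of probability at most
    [delta / 2]: large fourth moments, avoided by the choice of [K], and a large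
    deviation of the empirical mean or covariance, avoided by the choice of [N].
    Since [K] does not depend on [N], the accuracy [eta] can be fixed in
    between. *)
Lemma fbm_directions (T delta : R) : 0 < T -> 0 < delta ->
  exists A : set Omega, [/\ measurable A, (P A <= delta%:E)%E &
    forall w, ~ A w -> exists2 kappa : R, 0 < kappa &
      forall e, exists2 s, 0 <= s <= T & kappa * norm1 e <= dotv (X s w) e].
Proof.
move=> T0 d0.
have Qge0 e : 0 <= bform Q e e.
  have [_ _ /(_ e)[c [B [fB cB]]]] := fX.
  by rewrite (fbm_scale fB cB) sqr_ge0.
have [lam lam0 lamQ] := nondegenerate_form_coercive n0 covariance_mx_sym rQ Qge0.
have [C1 [C2 [C10 C20 est]]] := fbm_sample_estimates.
pose K := 2 * C2 / delta + 1.
have K0 : 0 < K by rewrite ltr_wpDl// divr_ge0 ?mulr_ge0// ltW.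
pose a := 1 + 4 * K / lam.
have a1 : 1 <= a by rewrite lerDl divr_ge0 ?mulr_ge0// ltW.
have a0 : 0 < a by exact: lt_le_trans a1.
have a3 : 0 < 1 + 3 * a by rewrite addr_gt0// mulr_gt0.
pose eta := lam / (2 * (1 + 3 * a)).
have eta0 : 0 < eta by rewrite divr_gt0// mulr_gt0.
have small : eta * (1 + 3 * a) + K / a ^+ 2 < lam.
  have -> : eta * (1 + 3 * a) = lam / 2 by rewrite /eta; field; exact: lt0r_neq0.
  have : K / a ^+ 2 <= lam / 4.
    rewrite ler_pdivrMr ?exprn_gt0//.
    apply: (@le_trans _ _ (lam / 4 * a)).
      rewrite /a (_ : lam / 4 * _ = lam / 4 + K); last by field; exact: lt0r_neq0.
      by rewrite lerDr divr_ge0// ltW.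
    by rewrite ler_wpM2l ?divr_ge0 ?(ltW lam0)// expr2 ler_peMl// ltW.
  lra.
clearbody eta a.
pose N := (Num.bound (2 * C1 / (eta ^+ 2 * delta))).+1.
have N0 : (0 < N)%N by [].
have Nr0 : 0 < N%:R :> R by rewrite ltr0n.
have NC : 2 * C1 / (eta ^+ 2 * delta) <= N%:R.
  have /archi_boundP/ltW/le_trans : 0 <= 2 * C1 / (eta ^+ 2 * delta).
    by apply: divr_ge0; [exact: mulr_ge0 | rewrite mulr_ge0 ?sqr_ge0// ltW].
  by apply; rewrite ler_nat leqW.
have [t [tT [pD mD pK mK]]] := est N T N0 T0.
set dev := (fun w => _) in pD mD; set kurt := (fun w => _) in pK mK.
have dev0 w : 0 <= dev w.
  by do 2![apply: sumr_ge0 => ? _]; rewrite addr_ge0// sqr_ge0.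
have kurt0 w : 0 <= kurt w.
  by do 3![apply: sumr_ge0 => ? _]; rewrite exprn_even_ge0.
have eN0 : 0 < (eta * N%:R) ^+ 2 by rewrite exprn_gt0// mulr_gt0.
have KN0 : 0 < K * N%:R by rewrite mulr_gt0.
have [mA1 PA1] := markov_mean eN0 pD dev0.
have [mA2 PA2] := markov_mean KN0 pK kurt0.
exists ([set w | (eta * N%:R) ^+ 2 <= dev w] `|` [set w | K * N%:R <= kurt w]); split.
- exact: measurableU.
- apply: (le_trans (measureU2 _ mA1 mA2)).
  apply: (le_trans (leeD PA1 PA2)); rewrite -EFinD lee_fin.
  have -> : delta = delta / 2 + delta / 2 by field.
  apply: lerD.
    rewrite ler_pdivrMr//; apply: le_trans mD _.
    move: NC; rewrite ler_pdivrMr ?mulr_gt0 ?exprn_gt0// => NC.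
    rewrite [leRHS](_ : _ = (N%:R * (eta ^+ 2 * delta)) / 2 * N%:R); last by field.
    by rewrite ler_pM2r// ler_pdivlMr// mulrC.
  rewrite ler_pdivrMr//; apply: le_trans mK _.
  rewrite mulrA ler_pM2r// /K mulrDr mulr1.
  rewrite (_ : delta / 2 * _ = C2); last by field; exact: lt0r_neq0.
  by rewrite lerDl divr_ge0// ltW.
move=> w /not_orP[/negP + /negP]; rewrite -!ltNge => devw kurtw.
pose z k := (t k `^ H)^-1 *: X (t k) w.
pose y i j k := (t k `^ H)^-1 * (X (t k) w 0 i + X (t k) w 0 j).
have zy i j k : z k 0 i + z k 0 j = y i j k by rewrite !mxE -mulrDr.
have tH k : 0 < t k `^ H by have /andP[t0 _] := tT k; exact: powR_gt0.
have devij i j : (\sum_k y i j k) ^+ 2 +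
      (\sum_k y i j k ^+ 2 - N%:R * (Q i i + Q j j + 2 * Q i j)) ^+ 2 <=
      (eta * N%:R) ^+ 2.
  apply: le_trans (ltW devw); apply: (@term_le_sum2 _ _ (fun i j => _ + _)) => i' j'.
  by rewrite addr_ge0// sqr_ge0.
have sqr_bound x : x ^+ 2 <= (eta * N%:R) ^+ 2 -> `|x| <= eta * N%:R.
  by rewrite -(real_normK (num_real x)) ler_pXn2r ?nnegrE ?mulr_ge0// ltW.
have hm i j : `|\sum_k (z k 0 i + z k 0 j)| <= eta * N%:R.
  under eq_bigr do rewrite zy; apply: sqr_bound; apply: le_trans (devij i j).
  by rewrite lerDl sqr_ge0.
have hv i j : `|\sum_k (z k 0 i + z k 0 j) ^+ 2 -
    N%:R * (Q i i + Q j j + 2 * Q i j)| <= eta * N%:R.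
  under eq_bigr do rewrite zy; apply: sqr_bound; apply: le_trans (devij i j).
  by rewrite lerDr sqr_ge0.
have h4 : \sum_k \sum_i \sum_j (z k 0 i + z k 0 j) ^+ 4 <= K * N%:R.
  under eq_bigr do under eq_bigr do under eq_bigr do rewrite zy.
  exact: ltW kurtw.
pose m := \big[Num.min/1]_k (t k `^ H).
have m0 : 0 < m by apply/bigmin_gtP.
exists (eta * m); first by rewrite mulr_gt0.
move=> e; have [k hk] := empirical_direction N0 (ltW eta0) a0 small hm hv h4 (lamQ e).
exists (t k); first by have /andP[/ltW-> ->] := tT k.
have dz : dotv (z k) e = (t k `^ H)^-1 * dotv (X (t k) w) e.
  by rewrite /dotv mulr_sumr; apply: eq_bigr => i _; rewrite !mxE mulrA.
move: hk; rewrite dz [X in _ <= X]mulrC ler_pdivlMr// => hk; apply: le_trans hk.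
rewrite mulrAC ler_wpM2l// ?bigmin_le_cond//.
by rewrite mulr_ge0 ?(ltW eta0)//; exact: sumr_ge0.
Qed.

End fbm_directions.

(** * Convex hulls of paths *)

Section hulls.
Context {R : realType} {n : nat}.
Implicit Types (A : set 'rV[R]_n).

Lemma closed_convex_hull_closed A : closed (closed_convex_hull A).
Proof. by apply: closed_bigI => C [[]]. Qed.

Lemma closed_convex_hull_convex A : @convex_set R 'rV[R]_n (closed_convex_hull A).
Proof.
move=> x y l /set_mem xA /set_mem yA; apply/mem_set => C CA.
have [[_ cC] _] := CA; apply/set_mem/cC; apply/mem_set; [exact: xA | exact: yA].
Qed.

Lemma subset_closed_convex_hull A : A `<=` closed_convex_hull A.
Proof. exact: sub_smallest. Qed.

Lemma closed_convex_hull_mono A B : A `<=` B ->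
  closed_convex_hull A `<=` closed_convex_hull B.
Proof. by move=> AB x xA C [CC BC]; apply: xA; split => //; exact: subset_trans BC. Qed.

End hulls.

Theorem theorem1 (R : realType) (disp : measure_display)
    (Omega : measurableType disp) (P : probability Omega R)
    (n : nat) (H : R) (X : R -> Omega -> 'rV[R]_n)
    (n_gt0 : (0 < n)%N) (H_gt0 : 0 < H) (H_neq1 : H != 1)
    (X_fbm : fractional_brownian_motion P H X)
    (X_cont : continuous_paths X)
    (X1_nondegenerate : \rank (covariance_mx P (X 1)) = n) :
  {ae P, forall w, forall t : R, 0 < t -> (path_hull X w t)^° 0}.
Proof.
have H_lt1 : H < 1.
  rewrite lt_neqAle H_neq1; have [_ _ /(_ 0)[c [B [fB _]]]] := X_fbm.
  exact: fbm_hurst_le1 fB H_gt0.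
have inv0 m : 0 < m.+1%:R^-1 :> R by rewrite invr_gt0 ltr0n.
have /choice[A AP] : forall p : nat * nat, exists A : set Omega,
    [/\ measurable A, (P A <= (p.2.+1%:R^-1)%:E)%E &
     forall w, ~ A w -> (path_hull X w p.1.+1%:R^-1)^° 0].
  move=> [m j]; have [A [mA PA wA]] :=
    fbm_directions n_gt0 H_gt0 H_lt1 X_fbm X1_nondegenerate (inv0 m) (inv0 j).
  exists A; split => // w /wA[kappa k0 dirs].
  apply: ball_of_directions k0 _.
  - exact: closed_convex_hull_closed.
  - exact: closed_convex_hull_convex.
  - move=> e; have [s sT se] := dirs e; exists (X s w) => //.
    by apply: subset_closed_convex_hull; exists s.
have null m : P.-negligible (\bigcap_j A (m, j)).
  have mA j : measurable (A (m, j)) by have [] := AP (m, j).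
  exists (\bigcap_j A (m, j)); split => //; first exact: bigcap_measurable.
  apply/eqP; rewrite eq_le measure_ge0 andbT; apply/lee_addgt0Pr => e e0.
  rewrite add0e; have [j je] : exists j, j.+1%:R^-1 <= e.
    exists (Num.bound e^-1); rewrite invf_ple ?posrE ?ltr0n//.
    by rewrite (le_trans (ltW (archi_boundP _)))// ?invr_ge0 ?ltW// ltr_nat.
  have [_ PA _] := AP (m, j); apply: (@le_trans _ _ (P (A (m, j)))).
    apply: le_measure; rewrite ?inE//; first exact: bigcap_measurable.
    exact: bigcap_inf.
  by apply: le_trans PA _; rewrite lee_fin.
apply: (negligibleS _ (negligible_bigcup null)) => w /= nint.
apply: contrapT => nA; apply: nint => t t0.
have [m mt] : exists m, m.+1%:R^-1 <= t.
  exists (Num.bound t^-1); rewrite invf_ple ?posrE ?ltr0n//.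
  by rewrite (le_trans (ltW (archi_boundP _)))// ?invr_ge0 ?ltW// ltr_nat.
have [j nAj] : exists j, ~ A (m, j) w.
  by apply/existsNP => Aj; apply: nA; exists m.
have [_ _ /(_ w nAj)] := AP (m, j).
apply: interiorS; apply: closed_convex_hull_mono => _ [s /= sm <-].
by exists s => //=; move: sm; rewrite !in_itv/= => /andP[-> /le_trans->].
Qed.
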